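(* Let $F:\mathbf C\to\mathbf D$ be a normal lax (or normal oplax) symmetric monoidal functor. Any two parallel formal morphisms for $F$ whose lifts to $\mathcal N_{sym}(\mathrm{ob}\,\mathbf C)$ induce the same bijection of letter occurrences are equal. In particular, if the letters involved are distinct, all formal diagrams for $F$ commute.
   Context: A lax symmetric monoidal functor is normal if its unit comparison $i:I\to F(I)$ is an isomorphism. The free normal lax symmetric monoidal functor on a set $T$ is $\Phi_T:\mathrm{Sym}(T)\to\mathcal N_{sym}(T)$, where $\mathrm{Sym}(T)$ is the free symmetric monoidal category on $T$ and $\mathcal N_{sym}(T)$ has objects the parenthesized words in formal units $I$ and terms $\Phi(w)$ ($w$ an object of $\mathrm{Sym}(T)$), and morphisms generated by associators, unitors and symmetries inside and outside $\Phi$-terms, invertible $i:I\to\Phi(I)$, and $m:\Phi(w)\otimes\Phi(w')\to\Phi(w\otimes w')$, modulo the relations making $\mathcal N_{sym}(T)$ symmetric monoidal and $\Phi_T$ a normal lax symmetric monoidal functor. It is the left adjoint to the functor from the category of normal lax symmetric monoidal functors (with morphisms commuting squares of strict symmetric monoidal functors) to sets taking objects of the source. A formal morphism for $F$ is the image of a morphism of $\mathcal N_{sym}(\mathrm{ob}\,\mathbf C)$ under the induced strict functor to $\mathbf D$. Each morphism of $\mathcal N_{sym}(T)$ induces a bijection between occurrences of letters (elements of $T$) in source and target. *)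

(* Defs.v *)
From Stdlib Require Import List Arith PeanoNat.

Record SymMonCat : Type := {
  ob : Type;
  hom : ob -> ob -> Type;
  idm : forall a, hom a a;
  comp : forall {a b c}, hom b c -> hom a b -> hom a c;
  comp_assoc : forall a b c d (f : hom a b) (g : hom b c) (h : hom c d),
      comp h (comp g f) = comp (comp h g) f;
  comp_idl : forall a b (f : hom a b), comp (idm b) f = f;
  comp_idr : forall a b (f : hom a b), comp f (idm a) = f;
  tens : ob -> ob -> ob;
  tensm : forall {a b c d}, hom a b -> hom c d -> hom (tens a c) (tens b d);
  tens_id : forall a b, tensm (idm a) (idm b) = idm (tens a b);
  tens_comp : forall a b c a' b' c' (f : hom a b) (g : hom b c)
      (f' : hom a' b') (g' : hom b' c'),
      tensm (comp g f) (comp g' f') = comp (tensm g g') (tensm f f');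
  unit : ob;
  alpha : forall a b c, hom (tens (tens a b) c) (tens a (tens b c));
  alphainv : forall a b c, hom (tens a (tens b c)) (tens (tens a b) c);
  lambda : forall a, hom (tens unit a) a;
  lambdainv : forall a, hom a (tens unit a);
  rho : forall a, hom (tens a unit) a;
  rhoinv : forall a, hom a (tens a unit);
  sigma : forall a b, hom (tens a b) (tens b a);
  alpha_nat : forall a b c a' b' c' (f : hom a a') (g : hom b b') (h : hom c c'),
      comp (alpha a' b' c') (tensm (tensm f g) h)
      = comp (tensm f (tensm g h)) (alpha a b c);
  alpha_inv1 : forall a b c, comp (alphainv a b c) (alpha a b c) = idm _;
  alpha_inv2 : forall a b c, comp (alpha a b c) (alphainv a b c) = idm _;
  lambda_nat : forall a b (f : hom a b),
      comp f (lambda a) = comp (lambda b) (tensm (idm unit) f);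
  lambda_inv1 : forall a, comp (lambdainv a) (lambda a) = idm _;
  lambda_inv2 : forall a, comp (lambda a) (lambdainv a) = idm _;
  rho_nat : forall a b (f : hom a b),
      comp f (rho a) = comp (rho b) (tensm f (idm unit));
  rho_inv1 : forall a, comp (rhoinv a) (rho a) = idm _;
  rho_inv2 : forall a, comp (rho a) (rhoinv a) = idm _;
  sigma_nat : forall a b a' b' (f : hom a a') (g : hom b b'),
      comp (sigma a' b') (tensm f g) = comp (tensm g f) (sigma a b);
  sigma_invol : forall a b, comp (sigma b a) (sigma a b) = idm _;
  pentagon : forall a b c d,
      comp (alpha a b (tens c d)) (alpha (tens a b) c d)
      = comp (tensm (idm a) (alpha b c d))
             (comp (alpha a (tens b c) d) (tensm (alpha a b c) (idm d)));
  triangle : forall a b,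
      comp (tensm (idm a) (lambda b)) (alpha a unit b) = tensm (rho a) (idm b);
  hexagon : forall a b c,
      comp (alpha b c a) (comp (sigma a (tens b c)) (alpha a b c))
      = comp (tensm (idm b) (sigma a c))
             (comp (alpha b a c) (tensm (sigma a b) (idm c)))
}.

Arguments idm {C} a : rename.
Arguments comp {C a b c} g f : rename.
Arguments tens {C} a b : rename.
Arguments tensm {C a b c d} f g : rename.
Arguments unit {C} : rename.
Arguments alpha {C} a b c : rename.
Arguments alphainv {C} a b c : rename.
Arguments lambda {C} a : rename.
Arguments lambdainv {C} a : rename.
Arguments rho {C} a : rename.
Arguments rhoinv {C} a : rename.
Arguments sigma {C} a b : rename.

Record NormalLaxSMF (C D : SymMonCat) : Type := {
  lfob : ob C -> ob D;
  lfmap : forall {a b}, hom C a b -> hom D (lfob a) (lfob b);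
  lfmap_id : forall a, lfmap (idm a) = idm (lfob a);
  lfmap_comp : forall a b c (f : hom C a b) (g : hom C b c),
      lfmap (comp g f) = comp (lfmap g) (lfmap f);
  mu : forall a b, hom D (tens (lfob a) (lfob b)) (lfob (tens a b));
  eta : hom D unit (lfob unit);
  etainv : hom D (lfob unit) unit;
  mu_nat : forall a b a' b' (f : hom C a a') (g : hom C b b'),
      comp (mu a' b') (tensm (lfmap f) (lfmap g)) = comp (lfmap (tensm f g)) (mu a b);
  mu_assoc : forall a b c,
      comp (lfmap (alpha a b c)) (comp (mu (tens a b) c) (tensm (mu a b) (idm (lfob c))))
      = comp (mu a (tens b c)) (comp (tensm (idm (lfob a)) (mu b c))
                                      (alpha (lfob a) (lfob b) (lfob c)));
  mu_unitl : forall a,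
      comp (lfmap (lambda a)) (comp (mu unit a) (tensm eta (idm (lfob a))))
      = lambda (lfob a);
  mu_unitr : forall a,
      comp (lfmap (rho a)) (comp (mu a unit) (tensm (idm (lfob a)) eta))
      = rho (lfob a);
  mu_sym : forall a b,
      comp (lfmap (sigma a b)) (mu a b) = comp (mu b a) (sigma (lfob a) (lfob b));
  eta_inv1 : comp etainv eta = idm unit;
  eta_inv2 : comp eta etainv = idm (lfob unit)
}.

Arguments lfob {C D} F a : rename.
Arguments lfmap {C D} F {a b} f : rename.
Arguments mu {C D} F a b : rename.
Arguments eta {C D} F : rename.
Arguments etainv {C D} F : rename.

Record NormalOplaxSMF (C D : SymMonCat) : Type := {
  ofob : ob C -> ob D;
  ofmap : forall {a b}, hom C a b -> hom D (ofob a) (ofob b);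
  ofmap_id : forall a, ofmap (idm a) = idm (ofob a);
  ofmap_comp : forall a b c (f : hom C a b) (g : hom C b c),
      ofmap (comp g f) = comp (ofmap g) (ofmap f);
  delta : forall a b, hom D (ofob (tens a b)) (tens (ofob a) (ofob b));
  eps : hom D (ofob unit) unit;
  epsinv : hom D unit (ofob unit);
  delta_nat : forall a b a' b' (f : hom C a a') (g : hom C b b'),
      comp (tensm (ofmap f) (ofmap g)) (delta a b) = comp (delta a' b') (ofmap (tensm f g));
  delta_assoc : forall a b c,
      comp (alpha (ofob a) (ofob b) (ofob c))
           (comp (tensm (delta a b) (idm (ofob c))) (delta (tens a b) c))
      = comp (tensm (idm (ofob a)) (delta b c))
             (comp (delta a (tens b c)) (ofmap (alpha a b c)));
  delta_unitl : forall a,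
      comp (lambda (ofob a)) (comp (tensm eps (idm (ofob a))) (delta unit a))
      = ofmap (lambda a);
  delta_unitr : forall a,
      comp (rho (ofob a)) (comp (tensm (idm (ofob a)) eps) (delta a unit))
      = ofmap (rho a);
  delta_sym : forall a b,
      comp (sigma (ofob a) (ofob b)) (delta a b) = comp (delta b a) (ofmap (sigma a b));
  eps_inv1 : comp epsinv eps = idm (ofob unit);
  eps_inv2 : comp eps epsinv = idm unit
}.

Arguments ofob {C D} F a : rename.
Arguments ofmap {C D} F {a b} f : rename.
Arguments delta {C D} F a b : rename.
Arguments eps {C D} F : rename.
Arguments epsinv {C D} F : rename.

(* Syntax of Sym(T): parenthesized words in letters of T and I, and
   (representatives of) morphisms generated by the structure maps.    *)
Inductive word (T : Type) : Type :=
  | wI : word T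
  | wv : T -> word T
  | wt : word T -> word T -> word T.
Arguments wI {T}.
Arguments wv {T} t.
Arguments wt {T} u v.

Inductive smor {T : Type} : word T -> word T -> Type :=
  | s_id : forall u, smor u u
  | s_comp : forall u v w, smor v w -> smor u v -> smor u w
  | s_tens : forall u u' v v', smor u u' -> smor v v' -> smor (wt u v) (wt u' v')
  | s_alpha : forall u v w, smor (wt (wt u v) w) (wt u (wt v w))
  | s_alphainv : forall u v w, smor (wt u (wt v w)) (wt (wt u v) w)
  | s_lambda : forall u, smor (wt wI u) u
  | s_lambdainv : forall u, smor u (wt wI u)
  | s_rho : forall u, smor (wt u wI) u
  | s_rhoinv : forall u, smor u (wt u wI)
  | s_sigma : forall u v, smor (wt u v) (wt v u).

Fixpoint wletters {T} (w : word T) : list T :=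
  match w with
  | wI => nil
  | wv t => t :: nil
  | wt u v => wletters u ++ wletters v
  end.

Definition wlen {T} (w : word T) : nat := length (wletters w).

(* Bijection of letter occurrences (by left-to-right position) induced
   by a morphism of Sym(T): position i in source |-> position in target. *)
Fixpoint sperm {T} {u v : word T} (f : smor u v) : nat -> nat :=
  match f with
  | s_id _ => fun i => i
  | s_comp _ _ _ g f => fun i => sperm g (sperm f i)
  | s_tens u u' _ _ f g =>
      fun i => if i <? wlen u then sperm f i else wlen u' + sperm g (i - wlen u)
  | s_sigma u v =>
      fun i => if i <? wlen u then wlen v + i else i - wlen u
  | _ => fun i => i
  end.

Fixpoint wev (C : SymMonCat) (w : word (ob C)) : ob C :=
  match w with
  | wI => unit
  | wv a => a
  | wt u v => tens (wev C u) (wev C v)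
  end.

Fixpoint sinterp (C : SymMonCat) {u v : word (ob C)} (f : smor u v)
  : hom C (wev C u) (wev C v) :=
  match f in smor u v return hom C (wev C u) (wev C v) with
  | s_id u => idm _
  | s_comp _ _ _ g f => comp (sinterp C g) (sinterp C f)
  | s_tens _ _ _ _ f g => tensm (sinterp C f) (sinterp C g)
  | s_alpha u v w => alpha _ _ _
  | s_alphainv u v w => alphainv _ _ _
  | s_lambda u => lambda _
  | s_lambdainv u => lambdainv _
  | s_rho u => rho _
  | s_rhoinv u => rhoinv _
  | s_sigma u v => sigma _ _
  end.

(* Syntax of N_sym(T): objects are parenthesized words in formal units
   I and terms Phi(w).  Morphisms (representatives) are generated by
   structure maps outside Phi, Phi applied to morphisms of Sym(T),
   i : I -> Phi(I) and its inverse, and the comparison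
   m : Phi w (x) Phi w' -> Phi (w (x) w')   when lax = true
   (resp. its oplax counterpart Phi (w (x) w') -> Phi w (x) Phi w'
    when lax = false, used for normal oplax functors).               *)
Inductive nob (T : Type) : Type :=
  | nI : nob T
  | nPhi : word T -> nob T
  | nt : nob T -> nob T -> nob T.
Arguments nI {T}.
Arguments nPhi {T} w.
Arguments nt {T} a b.

Inductive nmor {T : Type} (lax : bool) : nob T -> nob T -> Type :=
  | n_id : forall a, nmor lax a a
  | n_comp : forall a b c, nmor lax b c -> nmor lax a b -> nmor lax a c
  | n_tens : forall a a' b b', nmor lax a a' -> nmor lax b b' ->
      nmor lax (nt a b) (nt a' b')
  | n_alpha : forall a b c, nmor lax (nt (nt a b) c) (nt a (nt b c))
  | n_alphainv : forall a b c, nmor lax (nt a (nt b c)) (nt (nt a b) c)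
  | n_lambda : forall a, nmor lax (nt nI a) a
  | n_lambdainv : forall a, nmor lax a (nt nI a)
  | n_rho : forall a, nmor lax (nt a nI) a
  | n_rhoinv : forall a, nmor lax a (nt a nI)
  | n_sigma : forall a b, nmor lax (nt a b) (nt b a)
  | n_phi : forall u v, smor u v -> nmor lax (nPhi u) (nPhi v)
  | n_i : nmor lax nI (nPhi wI)
  | n_iinv : nmor lax (nPhi wI) nI
  | n_m : forall u v,
      nmor lax (if lax then nt (nPhi u) (nPhi v) else nPhi (wt u v))
               (if lax then nPhi (wt u v) else nt (nPhi u) (nPhi v)).

Fixpoint nletters {T} (a : nob T) : list T :=
  match a with
  | nI => nil
  | nPhi w => wletters w
  | nt a b => nletters a ++ nletters b
  end.

Definition nlen {T} (a : nob T) : nat := length (nletters a).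

Fixpoint nperm {T} {lax} {a b : nob T} (f : nmor lax a b) : nat -> nat :=
  match f with
  | n_comp _ _ _ _ g f => fun i => nperm g (nperm f i)
  | n_tens _ a a' _ _ f g =>
      fun i => if i <? nlen a then nperm f i else nlen a' + nperm g (i - nlen a)
  | n_sigma _ a b =>
      fun i => if i <? nlen a then nlen b + i else i - nlen a
  | n_phi _ _ _ f => sperm f
  | _ => fun i => i
  end.

Definition same_bijection {T} {lax} {a b : nob T} (f g : nmor lax a b) : Prop :=
  forall i, i < nlen a -> nperm f i = nperm g i.

(* Formal morphisms: images under the strict symmetric monoidal functor
   N_sym(ob C) -> D induced by F.                                       *)
Fixpoint lob {C D : SymMonCat} (F : NormalLaxSMF C D) (a : nob (ob C)) : ob D :=
  match a with
  | nI => unit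
  | nPhi w => lfob F (wev C w)
  | nt a b => tens (lob F a) (lob F b)
  end.

Fixpoint linterp {C D : SymMonCat} (F : NormalLaxSMF C D) {a b : nob (ob C)}
  (f : nmor true a b) : hom D (lob F a) (lob F b) :=
  match f in nmor _ a b return hom D (lob F a) (lob F b) with
  | n_id _ _ => idm _
  | n_comp _ _ _ _ g f => comp (linterp F g) (linterp F f)
  | n_tens _ _ _ _ _ f g => tensm (linterp F f) (linterp F g)
  | n_alpha _ _ _ _ => alpha _ _ _
  | n_alphainv _ _ _ _ => alphainv _ _ _
  | n_lambda _ _ => lambda _
  | n_lambdainv _ _ => lambdainv _
  | n_rho _ _ => rho _
  | n_rhoinv _ _ => rhoinv _
  | n_sigma _ _ _ => sigma _ _
  | n_phi _ _ _ f => lfmap F (sinterp C f)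
  | n_i _ => eta F
  | n_iinv _ => etainv F
  | n_m _ u v => mu F (wev C u) (wev C v)
  end.

Fixpoint oob {C D : SymMonCat} (F : NormalOplaxSMF C D) (a : nob (ob C)) : ob D :=
  match a with
  | nI => unit
  | nPhi w => ofob F (wev C w)
  | nt a b => tens (oob F a) (oob F b)
  end.

Fixpoint ointerp {C D : SymMonCat} (F : NormalOplaxSMF C D) {a b : nob (ob C)}
  (f : nmor false a b) : hom D (oob F a) (oob F b) :=
  match f in nmor _ a b return hom D (oob F a) (oob F b) with
  | n_id _ _ => idm _
  | n_comp _ _ _ _ g f => comp (ointerp F g) (ointerp F f)
  | n_tens _ _ _ _ _ f g => tensm (ointerp F f) (ointerp F g)
  | n_alpha _ _ _ _ => alpha _ _ _
  | n_alphainv _ _ _ _ => alphainv _ _ _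
  | n_lambda _ _ => lambda _
  | n_lambdainv _ _ => lambdainv _
  | n_rho _ _ => rho _
  | n_rhoinv _ _ => rhoinv _
  | n_sigma _ _ _ => sigma _ _
  | n_phi _ _ _ f => ofmap F (sinterp C f)
  | n_i _ => epsinv F
  | n_iinv _ => eps F
  | n_m _ u v => delta F (wev C u) (wev C v)
  end.

(* Main.v *)
Require Import Defs.
From Stdlib Require Import List Arith PeanoNat Lia Eqdep FunctionalExtensionality JMeq.

(** Coherence in a symmetric monoidal category goes by induction on the number of letters:
    a formal morphism commutes with the extraction of a letter to the front, and once no
    letter is left every word collapses canonically to the unit.

    For a normal lax functor, multiplying out all bubbles turns a formal morphism [a -> b] into
    [F] of a formal morphism of the source category, so that when [b] is [I] or a single
    bubble [Phi w] the claim reduces to the first part. If [b] is a tensor product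
    [b1 (x) b2], let [P] be the set of letters ending up in [b1], and let [a|P] be [a] with the
    letters outside [P] replaced by units. The comparison maps of [F] give a natural map
    [a|P (x) a|~P -> a], which is split epi because each bubble of [a] goes entirely to
    [b1] or entirely to [b2]. Hence a morphism [a -> b] is determined by its restrictions to
    [P] and to the complement of [P], and these amount to morphisms into [b1] and into [b2],
    as letterless objects are canonically isomorphic to [I] by normality.

    The oplax case is the lax case for the opposite categories. *)

Local Notation "g ∙ f" := (comp g f) (at level 39, right associativity).
Local Notation "f ⊗ g" := (tensm f g) (at level 37, right associativity).
Local Notation "a ⊠ b" := (tens a b) (at level 37, right associativity).
Local Notation "𝟙" := (idm _).

(** * Equations in a symmetric monoidal category *)

Section Equations.
Context {C : SymMonCat}.
Implicit Types a b c d : ob C.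

(** Composites are kept nested to the right, where the left-hand side of an equation is usually not
    a subterm; this form and the next allow rewriting there. *)
Lemma post2 {a b c d} {g : hom C b c} {f : hom C a b} {k} (E : g ∙ f = k) (x : hom C d a) :
  g ∙ (f ∙ x) = k ∙ x.
Proof. now rewrite comp_assoc, E. Qed.

Lemma post3 {a b c d e} {h : hom C c d} {g : hom C b c} {f : hom C a b} {k}
  (E : h ∙ g ∙ f = k) (x : hom C e a) : h ∙ g ∙ f ∙ x = k ∙ x.
Proof. now rewrite <- E, <- !comp_assoc. Qed.

Lemma tensl_comp {a b c} d (f : hom C a b) (g : hom C b c) :
  (g ∙ f) ⊗ idm d = (g ⊗ 𝟙) ∙ (f ⊗ 𝟙).
Proof. now rewrite <- tens_comp, comp_idl. Qed.

Lemma tensr_comp {a b c} d (f : hom C a b) (g : hom C b c) :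
  idm d ⊗ (g ∙ f) = (𝟙 ⊗ g) ∙ (𝟙 ⊗ f).
Proof. now rewrite <- tens_comp, comp_idl. Qed.

Lemma tensr_comp_left {a b c d e} (k : hom C d e) (f : hom C a b) (g : hom C b c) :
  k ⊗ (g ∙ f) = (𝟙 ⊗ g) ∙ (k ⊗ f).
Proof. now rewrite <- tens_comp, comp_idl. Qed.

Lemma tensl_comp_left {a b c d e} (k : hom C d e) (f : hom C a b) (g : hom C b c) :
  (g ∙ f) ⊗ k = (g ⊗ 𝟙) ∙ (f ⊗ k).
Proof. now rewrite <- tens_comp, comp_idl. Qed.

Definition is_epi {a b} (e : hom C a b) := forall c (f g : hom C b c), f ∙ e = g ∙ e -> f = g.

Lemma split_epi {a b} (e : hom C a b) s : e ∙ s = 𝟙 -> is_epi e.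
Proof.
  intros E c f g H. rewrite <- (comp_idr C _ _ f), <- (comp_idr C _ _ g), <- E.
  now rewrite !comp_assoc, H.
Qed.

Lemma split_mono {a b} (m : hom C a b) s : s ∙ m = 𝟙 ->
  forall c (f g : hom C c a), m ∙ f = m ∙ g -> f = g.
Proof.
  intros E c f g H. rewrite <- (comp_idl C _ _ f), <- (comp_idl C _ _ g), <- E.
  now rewrite <- !comp_assoc, H.
Qed.

Lemma epi_comp {a b c} (e : hom C a b) (e' : hom C b c) :
  is_epi e -> is_epi e' -> is_epi (e' ∙ e).
Proof. intros H H' d f g E. apply H', H. now rewrite <- !comp_assoc. Qed.

Lemma epi_alpha a b c : is_epi (alpha a b c).
Proof. exact (split_epi _ _ (alpha_inv2 C a b c)). Qed.

Lemma epi_tens {a b c d} (f : hom C a b) (g : hom C c d) s t :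
  f ∙ s = 𝟙 -> g ∙ t = 𝟙 -> is_epi (f ⊗ g).
Proof.
  intros E E'. apply (split_epi _ (s ⊗ t)). now rewrite <- tens_comp, E, E', tens_id.
Qed.

(** Naturality of [lambda] makes tensoring with the unit isomorphic to the identity functor. The
    coherence equations for units below are checked after such a tensoring, where pentagon, triangle
    and hexagon apply. *)
Lemma unit_tens_faithful {a b} (f g : hom C a b) : idm unit ⊗ f = idm unit ⊗ g -> f = g.
Proof.
  intros H. apply (split_epi _ _ (lambda_inv2 C a)). now rewrite !lambda_nat, H.
Qed.

Lemma tens_unit_faithful {a b} (f g : hom C a b) : f ⊗ idm unit = g ⊗ idm unit -> f = g.
Proof.
  intros H. apply (split_epi _ _ (rho_inv2 C a)). now rewrite !rho_nat, H.
Qed.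

(** Kelly's argument: tensored with the unit on the left and precomposed with invertible
    associators, this becomes the pentagon at [unit], [unit], [a], [b] combined with triangles. *)
Lemma lambda_tens a b : lambda (a ⊠ b) ∙ alpha unit a b = lambda a ⊗ idm b.
Proof.
  apply unit_tens_faithful.
  apply (epi_comp (alpha unit unit a ⊗ idm b) (alpha unit (unit ⊠ a) b)).
  - eapply epi_tens; [apply alpha_inv2 | apply comp_idl].
  - apply epi_alpha.
  - rewrite tensr_comp, <- comp_assoc, <- pentagon, comp_assoc, triangle.
    rewrite <- tens_id, <- alpha_nat, <- triangle, tensl_comp.
    now rewrite (comp_assoc C _ _ _ _ (alpha unit unit a ⊗ 𝟙)), alpha_nat, <- !comp_assoc.
Qed.

Lemma rho_tens a b : rho (a ⊠ b) = (idm a ⊗ rho b) ∙ alpha a b unit.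
Proof.
  apply tens_unit_faithful.
  apply (split_mono _ _ (alpha_inv1 C a b unit)).
  rewrite <- triangle, <- tens_id, comp_assoc, alpha_nat, <- comp_assoc, pentagon.
  rewrite comp_assoc, <- tens_comp, triangle, comp_idl, comp_assoc, <- alpha_nat.
  now rewrite tensl_comp, <- comp_assoc.
Qed.

Lemma lambda_rho_unit : lambda unit = rho (@unit C).
Proof.
  apply tens_unit_faithful. rewrite <- lambda_tens, <- triangle. f_equal.
  apply (split_mono _ _ (lambda_inv1 C unit)). apply lambda_nat.
Qed.

(** The hexagon at [a], [unit], [unit], after tensoring with the unit and cancelling an invertible
    symmetry. *)
Lemma lambda_sigma a : lambda a ∙ sigma a unit = rho a.
Proof.
  apply tens_unit_faithful.
  apply (split_mono _ _ (sigma_invol C a unit)).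
  rewrite <- triangle, tensl_comp.
  rewrite (comp_assoc C _ _ _ _ (alpha a unit unit)), (sigma_nat C _ _ _ _ (idm a) (lambda unit)).
  rewrite <- (lambda_tens unit a), <- (lambda_tens a unit).
  rewrite <- !comp_assoc, hexagon, (comp_assoc C _ _ _ _ _ (lambda (a ⊠ unit))).
  now rewrite lambda_nat, <- !comp_assoc.
Qed.

Lemma rho_sigma a : rho a ∙ sigma unit a = lambda a.
Proof. now rewrite <- lambda_sigma, <- comp_assoc, sigma_invol, comp_idr. Qed.

Lemma pentagon_alphainv a b c d :
  alpha a (b ⊠ c) d ∙ (alpha a b c ⊗ idm d) ∙ alphainv (a ⊠ b) c d
  = (idm a ⊗ alphainv b c d) ∙ alpha a b (c ⊠ d).
Proof.
  apply (split_mono (idm a ⊗ alpha b c d) (idm a ⊗ alphainv b c d)).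
  { now rewrite <- tens_comp, alpha_inv1, comp_idl, tens_id. }
  rewrite !comp_assoc, <- tens_comp, alpha_inv2, comp_idl, tens_id, comp_idl.
  rewrite <- (comp_assoc C _ _ _ _ _ (alpha a (b ⊠ c) d)), <- pentagon.
  now rewrite <- !comp_assoc, alpha_inv2, comp_idr.
Qed.

(** The elementary move that carries a letter sitting in front of the right factor past the whole
    left factor. *)
Definition braid a b c : hom C (a ⊠ (b ⊠ c)) (b ⊠ (a ⊠ c)) :=
  alpha b a c ∙ (sigma a b ⊗ idm c) ∙ alphainv a b c.

Lemma alphainv_nat a b c a' b' c' (f : hom C a a') (g : hom C b b') (h : hom C c c') :
  alphainv a' b' c' ∙ (f ⊗ (g ⊗ h)) = ((f ⊗ g) ⊗ h) ∙ alphainv a b c.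
Proof.
  apply (split_mono _ _ (alpha_inv1 C a' b' c')).
  rewrite !comp_assoc, alpha_inv2, alpha_nat, comp_idl.
  now rewrite <- comp_assoc, alpha_inv2, comp_idr.
Qed.

Lemma braid_nat a b c a' b' c' (f : hom C a a') (g : hom C b b') (h : hom C c c') :
  braid a' b' c' ∙ (f ⊗ (g ⊗ h)) = (g ⊗ (f ⊗ h)) ∙ braid a b c.
Proof.
  unfold braid. rewrite <- !comp_assoc, alphainv_nat.
  rewrite (comp_assoc C _ _ _ _ _ ((f ⊗ g) ⊗ h)), <- tens_comp, sigma_nat.
  rewrite comp_idl, <- (comp_idr C _ _ h), tens_comp, !comp_assoc, alpha_nat.
  now rewrite (comp_idr C _ _ h).
Qed.

(** Only naturality and two pentagons are at work: the factor [d] is a spectator to the exchange of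
    [a] and [b]. *)
Lemma braid_tens_right a b c d :
  braid a b (c ⊠ d) ∙ (idm a ⊗ alpha b c d) ∙ alpha a (b ⊠ c) d
  = (idm b ⊗ alpha a c d) ∙ alpha b (a ⊠ c) d ∙ (braid a b c ⊗ idm d).
Proof.
  apply (split_epi (alpha a b c ⊗ idm d) (alphainv a b c ⊗ idm d)).
  { now rewrite <- tens_comp, alpha_inv2, comp_idl, tens_id. }
  unfold braid. rewrite <- !comp_assoc, <- pentagon.
  rewrite (post2 (alpha_inv1 C a b (c ⊠ d))), comp_idl.
  rewrite <- tens_comp, <- !comp_assoc, alpha_inv1, comp_idr.
  rewrite tens_comp, (comp_assoc C _ _ _ _ _ (alpha b a c ⊗ 𝟙)).
  rewrite (comp_assoc C _ _ _ _ _ _ (idm b ⊗ _)), <- pentagon.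
  now rewrite <- (tens_id C c d), <- comp_assoc, alpha_nat.
Qed.

(** This is the second hexagon. As [sigma] is an involution, it is the inverse of the axiom
    [hexagon] at [c], [a], [b]. *)
Lemma sigma_tens_left a b c :
  sigma (a ⊠ b) c = braid a c b ∙ (idm a ⊗ sigma b c) ∙ alpha a b c.
Proof.
  apply (split_epi (sigma c (a ⊠ b)) _ (sigma_invol C (a ⊠ b) c)).
  apply (epi_alpha c a b).
  rewrite sigma_invol, comp_idl, <- !comp_assoc, hexagon.
  rewrite (comp_assoc C _ _ _ _ _ (idm a ⊗ sigma c b)), <- tens_comp, sigma_invol, comp_idl, tens_id, comp_idl.
  unfold braid. rewrite <- !comp_assoc, (post2 (alpha_inv1 C a c b)), comp_idl.
  now rewrite <- tens_comp, sigma_invol, comp_idl, tens_id, comp_idr.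
Qed.

Lemma braid_tens_left a b c d :
  braid a c (b ⊠ d) ∙ (idm a ⊗ braid b c d) ∙ alpha a b (c ⊠ d)
  = (idm c ⊗ alpha a b d) ∙ braid (a ⊠ b) c d.
Proof.
  unfold braid at 3. rewrite sigma_tens_left.
  rewrite !tensl_comp, <- !comp_assoc.
  rewrite (post3 (eq_sym (braid_tens_right a c b d))), <- !comp_assoc.
  rewrite (post2 (alpha_nat C _ _ _ _ _ _ (idm a) (sigma b c) (idm d))), <- !comp_assoc.
  rewrite pentagon_alphainv.
  unfold braid at 2. now rewrite !tensr_comp, <- !comp_assoc.
Qed.

Lemma braid_invol a b c : braid b a c ∙ braid a b c = 𝟙.
Proof.
  unfold braid. rewrite <- !comp_assoc, (post2 (alpha_inv1 C b a c)), comp_idl.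
  rewrite (comp_assoc C _ _ _ _ _ (sigma a b ⊗ 𝟙)), <- tens_comp, sigma_invol, comp_idl, tens_id, comp_idl.
  apply alpha_inv2.
Qed.

Lemma braid_sigma_left a b c :
  braid c a b ∙ sigma (a ⊠ b) c = (idm a ⊗ sigma b c) ∙ alpha a b c.
Proof. now rewrite sigma_tens_left, comp_assoc, braid_invol, comp_idl. Qed.

Lemma braid_sigma_right a b c :
  alpha b c a ∙ sigma a (b ⊠ c) = (idm b ⊗ sigma a c) ∙ braid a b c.
Proof.
  apply (epi_alpha a b c). unfold braid.
  now rewrite <- !comp_assoc, alpha_inv1, comp_idr, hexagon.
Qed.

Lemma braid_lambda a b : (idm a ⊗ lambda b) ∙ braid unit a b = lambda (a ⊠ b).
Proof.
  apply (epi_alpha unit a b). unfold braid.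
  rewrite <- !comp_assoc, alpha_inv1, comp_idr, comp_assoc, triangle.
  now rewrite lambda_tens, <- tens_comp, rho_sigma, comp_idl.
Qed.

(** Here [e] stands for the extraction of a letter [t] from one factor. This square and the
    following ones treat each structure map together with each factor that can contain the letter;
    they are the base cases of [remove_smor]. *)
Lemma extract_alpha_1 a b c t a' (e : hom C a (t ⊠ a')) :
  (alpha t a' (b ⊠ c) ∙ (e ⊗ 𝟙)) ∙ alpha a b c
  = (𝟙 ⊗ alpha a' b c) ∙ (alpha t (a' ⊠ b) c ∙ ((alpha t a' b ∙ (e ⊗ 𝟙)) ⊗ 𝟙)).
Proof.
  rewrite tensl_comp, (post3 (eq_sym (pentagon C t a' b c))), <- !comp_assoc.
  now rewrite <- (tens_id C b c), alpha_nat.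
Qed.

Lemma extract_alpha_2 a b c t b' (e : hom C b (t ⊠ b')) :
  (braid a t (b' ⊠ c) ∙ (𝟙 ⊗ (alpha t b' c ∙ (e ⊗ 𝟙)))) ∙ alpha a b c
  = (𝟙 ⊗ alpha a b' c) ∙ (alpha t (a ⊠ b') c ∙ ((braid a t b' ∙ (𝟙 ⊗ e)) ⊗ 𝟙)).
Proof.
  rewrite tensl_comp, (post3 (eq_sym (braid_tens_right a t b' c))), <- !comp_assoc.
  now rewrite tensr_comp, <- comp_assoc, alpha_nat.
Qed.

Lemma extract_alpha_3 a b c t c' (e : hom C c (t ⊠ c')) :
  (braid a t (b ⊠ c') ∙ (𝟙 ⊗ (braid b t c' ∙ (𝟙 ⊗ e)))) ∙ alpha a b c
  = (𝟙 ⊗ alpha a b c') ∙ (braid (a ⊠ b) t c' ∙ (𝟙 ⊗ e)).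
Proof.
  rewrite (comp_assoc C _ _ _ _ (𝟙 ⊗ e)), <- braid_tens_left, <- !comp_assoc.
  now rewrite tensr_comp, <- comp_assoc, <- (tens_id C a b), alpha_nat.
Qed.

Lemma extract_lambda a t a' (e : hom C a (t ⊠ a')) :
  e ∙ lambda a = (𝟙 ⊗ lambda a') ∙ (braid unit t a' ∙ (𝟙 ⊗ e)).
Proof. now rewrite comp_assoc, braid_lambda, lambda_nat. Qed.

Lemma extract_rho a t a' (e : hom C a (t ⊠ a')) :
  e ∙ rho a = (𝟙 ⊗ rho a') ∙ (alpha t a' unit ∙ (e ⊗ 𝟙)).
Proof. now rewrite comp_assoc, <- rho_tens, rho_nat. Qed.

Lemma extract_sigma_1 a b t a' (e : hom C a (t ⊠ a')) :
  (braid b t a' ∙ (𝟙 ⊗ e)) ∙ sigma a b = (𝟙 ⊗ sigma a' b) ∙ (alpha t a' b ∙ (e ⊗ 𝟙)).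
Proof. now rewrite comp_assoc, <- braid_sigma_left, <- !comp_assoc, sigma_nat. Qed.

Lemma extract_sigma_2 a b t b' (e : hom C b (t ⊠ b')) :
  (alpha t b' a ∙ (e ⊗ 𝟙)) ∙ sigma a b = (𝟙 ⊗ sigma a b') ∙ (braid a t b' ∙ (𝟙 ⊗ e)).
Proof. now rewrite comp_assoc, <- braid_sigma_right, <- !comp_assoc, sigma_nat. Qed.

(** The middle-four interchange, the comparison map of the tensor product regarded as a monoidal
    functor of two variables. *)
Definition exchange a b c d : hom C ((a ⊠ b) ⊠ (c ⊠ d)) ((a ⊠ c) ⊠ (b ⊠ d)) :=
  alphainv a c (b ⊠ d) ∙ (𝟙 ⊗ braid b c d) ∙ alpha a b (c ⊠ d).

Lemma exchange_nat a b c d a' b' c' d'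
  (f : hom C a a') (g : hom C b b') (h : hom C c c') (k : hom C d d') :
  exchange a' b' c' d' ∙ ((f ⊗ g) ⊗ (h ⊗ k)) = ((f ⊗ h) ⊗ (g ⊗ k)) ∙ exchange a b c d.
Proof.
  unfold exchange. rewrite <- !comp_assoc, alpha_nat.
  rewrite (comp_assoc C _ _ _ _ _ (f ⊗ _)), <- tens_comp, braid_nat.
  now rewrite comp_idl, <- (comp_idr C _ _ f), tens_comp, comp_assoc, comp_assoc,
     alphainv_nat, <- !comp_assoc, (comp_idr C _ _ f).
Qed.

End Equations.

(** * Letter occurrences and invertibility in the free symmetric monoidal category *)

Fixpoint pos {T} (w : word T) : Type :=
  match w with
  | wI => Empty_set
  | wv _ => Datatypes.unit
  | wt u v => pos u + pos v
  end.

Fixpoint letter {T} (w : word T) : pos w -> T :=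
  match w with
  | wI => fun p => match p with end
  | wv t => fun _ => t
  | wt u v => fun p => match p with inl p => letter u p | inr p => letter v p end
  end.

(** A typed counterpart of [sperm]: with occurrences as leaves of the word, composition and tensor
    need no arithmetic. The two are compared in [sperm_index]. *)
Fixpoint smap {T} {u v : word T} (f : smor u v) : pos u -> pos v :=
  match f with
  | s_id _ => fun p => p
  | s_comp _ _ _ g f => fun p => smap g (smap f p)
  | s_tens _ _ _ _ f g => fun p =>
      match p with inl p => inl (smap f p) | inr p => inr (smap g p) end
  | s_alpha _ _ _ => fun p =>
      match p with
      | inl (inl p) => inl p | inl (inr p) => inr (inl p) | inr p => inr (inr p)
      end
  | s_alphainv _ _ _ => fun p =>
      match p with
      | inl p => inl (inl p) | inr (inl p) => inl (inr p) | inr (inr p) => inr p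
      end
  | s_lambda _ => fun p =>
      match p with inl p => match (p : Empty_set) with end | inr p => p end
  | s_lambdainv _ => inr
  | s_rho _ => fun p =>
      match p with inl p => p | inr p => match (p : Empty_set) with end end
  | s_rhoinv _ => inl
  | s_sigma _ _ => fun p => match p with inl p => inr p | inr p => inl p end
  end.

Fixpoint sinv {T} {u v : word T} (f : smor u v) : smor v u :=
  match f with
  | s_id _ => s_id _
  | s_comp _ _ _ g f => s_comp _ _ _ (sinv f) (sinv g)
  | s_tens _ _ _ _ f g => s_tens _ _ _ _ (sinv f) (sinv g)
  | s_alpha _ _ _ => s_alphainv _ _ _
  | s_alphainv _ _ _ => s_alpha _ _ _
  | s_lambda _ => s_lambdainv _
  | s_lambdainv _ => s_lambda _
  | s_rho _ => s_rhoinv _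
  | s_rhoinv _ => s_rho _
  | s_sigma _ _ => s_sigma _ _
  end.

Ltac split_pos :=
  repeat match goal with
  | p : Empty_set |- _ => destruct p
  | p : (_ + _)%type |- _ => destruct p
  | p : pos (wt _ _) |- _ => destruct p
  | p : pos wI |- _ => destruct p
  end.

Lemma smap_sinv {T} {u v : word T} (f : smor u v) q : smap f (smap (sinv f) q) = q.
Proof.
  induction f; cbn in *; split_pos; cbn;
  repeat match goal with H : forall _, _ = _ |- _ => rewrite H end; reflexivity.
Qed.

Lemma sinv_smap {T} {u v : word T} (f : smor u v) p : smap (sinv f) (smap f p) = p.
Proof.
  induction f; cbn in *; split_pos; cbn;
  repeat match goal with H : forall _, _ = _ |- _ => rewrite H end; reflexivity.
Qed.

Lemma letter_smap {T} {u v : word T} (f : smor u v) p : letter v (smap f p) = letter u p.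
Proof.
  induction f; cbn in *; split_pos; cbn;
  repeat match goal with H : forall _, _ = _ |- _ => rewrite H end; reflexivity.
Qed.

Lemma sinv_sinterp C {u v : word (ob C)} (f : smor u v) : sinterp C (sinv f) ∙ sinterp C f = 𝟙.
Proof.
  induction f; cbn; auto using comp_idl, alpha_inv1, alpha_inv2, lambda_inv1, lambda_inv2,
    rho_inv1, rho_inv2, sigma_invol.
  - rewrite <- comp_assoc, (comp_assoc C _ _ _ _ _ _ (sinterp C (sinv f1))), IHf1, comp_idl. exact IHf2.
  - now rewrite <- tens_comp, IHf1, IHf2, tens_id.
Qed.

(** * Coherence for symmetric monoidal categories *)

Fixpoint scollapse {T} (u : word T) : (pos u -> False) -> smor u wI :=
  match u with
  | wI => fun _ => s_id _
  | wv _ => fun h => match h tt with end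
  | wt u v => fun h => s_comp _ _ _ (s_lambda _)
      (s_tens _ _ _ _ (scollapse u (fun p => h (inl p))) (scollapse v (fun p => h (inr p))))
  end.

Fixpoint collapse C (u : word (ob C)) : (pos u -> False) -> hom C (wev C u) unit :=
  match u with
  | wI => fun _ => 𝟙
  | wv _ => fun h => match h tt with end
  | wt u v => fun h =>
      lambda _ ∙ (collapse C u (fun p => h (inl p)) ⊗ collapse C v (fun p => h (inr p)))
  end.

Lemma sinterp_scollapse C (u : word (ob C)) h : sinterp C (scollapse u h) = collapse C u h.
Proof.
  induction u; cbn; auto.
  - destruct (h tt).
  - now rewrite IHu1, IHu2.
Qed.

(** On generators this is naturality together with the triangle, [lambda_sigma] and
    [lambda_rho_unit]; the inverse structure maps follow by cancellation. *)
Lemma collapse_nat C {u v : word (ob C)} (f : smor u v) h h' :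
  collapse C v h ∙ sinterp C f = collapse C u h'.
Proof.
  (* Proofs of emptiness are functions, so their irrelevance is obtained by induction on the
     word. *)
  assert (irr : forall u h h', collapse C u h = collapse C u h').
  { clear. induction u; cbn; intros h h'; auto.
    - destruct (h tt).
    - now rewrite (IHu1 _ (fun p => h' (inl p))), (IHu2 _ (fun p => h' (inr p))). }
  assert (H_alpha : forall u v w h h',
    collapse C (wt u (wt v w)) h ∙ alpha (wev C u) (wev C v) (wev C w)
    = collapse C (wt (wt u v) w) h').
  { clear - irr. intros. cbn.
    rewrite (irr u _ (fun p => h' (inl (inl p)))), (irr v _ (fun p => h' (inl (inr p)))),
      (irr w _ (fun p => h' (inr p))).
    rewrite tensr_comp_left, <- !comp_assoc, <- alpha_nat.
    rewrite (comp_assoc C _ _ _ _ _ _ (𝟙 ⊗ _)), triangle, <- lambda_rho_unit.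
    now rewrite <- tensl_comp_left. }
  assert (H_lambda : forall u h h', collapse C u h ∙ lambda _ = collapse C (wt wI u) h').
  { clear - irr. intros. cbn. rewrite (irr u _ (fun p => h' (inr p))). apply lambda_nat. }
  assert (H_rho : forall u h h', collapse C u h ∙ rho _ = collapse C (wt u wI) h').
  { clear - irr. intros. cbn. rewrite (irr u _ (fun p => h' (inl p))), lambda_rho_unit. apply rho_nat. }
  revert h h'; induction f; intros h h'.
  - cbn. rewrite comp_idr. apply irr.
  - cbn. assert (k : pos v -> False) by (intros p; exact (h (smap f1 p))).
    now rewrite comp_assoc, (IHf1 h k), (IHf2 k h').
  - cbn. rewrite <- comp_assoc, <- tens_comp. now erewrite IHf1, IHf2.
  - apply H_alpha.
  - rewrite <- (H_alpha _ _ _ h' h), <- comp_assoc. cbn. now rewrite alpha_inv2, comp_idr.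
  - apply H_lambda.
  - rewrite <- (H_lambda _ h' h), <- comp_assoc. cbn. now rewrite lambda_inv2, comp_idr.
  - apply H_rho.
  - rewrite <- (H_rho _ h' h), <- comp_assoc. cbn. now rewrite rho_inv2, comp_idr.
  - cbn. rewrite (irr u _ (fun p => h' (inl p))), (irr v _ (fun p => h' (inr p))).
    rewrite <- comp_assoc, <- sigma_nat, comp_assoc, lambda_sigma.
    now rewrite lambda_rho_unit.
Qed.

(* Collecting the letter at [p] in front leaves a unit behind, so that the remaining
   occurrences keep their bracketing. *)
Fixpoint remove {T} (u : word T) : pos u -> word T :=
  match u with
  | wI => fun p => match p with end
  | wv _ => fun _ => wI
  | wt u v => fun p => match p with
      | inl p => wt (remove u p) v | inr p => wt u (remove v p) end
  end.

Fixpoint remove_inj {T} (u : word T) : forall p, pos (remove u p) -> pos u :=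
  match u with
  | wI => fun p => match p with end
  | wv _ => fun _ r => match (r : Empty_set) with end
  | wt u v => fun p => match p with
      | inl p => fun r : pos (wt (remove u p) v) =>
          match r with inl r => inl (remove_inj u p r) | inr r => inr r end
      | inr p => fun r : pos (wt u (remove v p)) =>
          match r with inl r => inl r | inr r => inr (remove_inj v p r) end
      end
  end.

Lemma remove_inj_inj {T} (u : word T) p r s : remove_inj u p r = remove_inj u p s -> r = s.
Proof.
  revert p r s; induction u; cbn; intros.
  - destruct p.
  - destruct r.
  - destruct p, r, s; cbn in *; try congruence; f_equal.
    + eapply IHu1; congruence.
    + eapply IHu2; congruence.
Qed.

Lemma remove_wlen {T} (u : word T) p : wlen u = S (wlen (remove u p)).
Proof.
  unfold wlen; revert p; induction u; intros p; cbn in *; split_pos; cbn; auto;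
    rewrite !length_app; [now rewrite (IHu1 p) | rewrite (IHu2 p); lia].
Qed.

(* Uniqueness of identity proofs is unavoidable: [s_id] transported along a loop [t = t] of
   objects is again a formal morphism with the identity bijection. *)
Definition cast {C : SymMonCat} {a b : ob C} (e : a = b) : hom C a b :=
  match e with eq_refl => 𝟙 end.

Lemma cast_id {C : SymMonCat} {a : ob C} (e : a = a) : cast e = 𝟙.
Proof. now rewrite (UIP_refl _ _ e). Qed.

Lemma cast_comp {C : SymMonCat} {a b c : ob C} (e : a = b) (e' : b = c) (e'' : a = c) :
  cast e' ∙ cast e = cast e''.
Proof. destruct e', e. rewrite !cast_id. apply comp_idl. Qed.

Fixpoint extract C (u : word (ob C)) :
  forall p, hom C (wev C u) (letter u p ⊠ wev C (remove u p)) :=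
  match u with
  | wI => fun p => match p with end
  | wv _ => fun _ => rhoinv _
  | wt u v => fun p => match p with
      | inl p => alpha _ _ _ ∙ (extract C u p ⊗ 𝟙)
      | inr p => braid _ _ _ ∙ (𝟙 ⊗ extract C v p)
      end
  end.

Fixpoint extractinv C (u : word (ob C)) :
  forall p, hom C (letter u p ⊠ wev C (remove u p)) (wev C u) :=
  match u with
  | wI => fun p => match p with end
  | wv _ => fun _ => rho _
  | wt u v => fun p => match p with
      | inl p => (extractinv C u p ⊗ 𝟙) ∙ alphainv _ _ _
      | inr p => (𝟙 ⊗ extractinv C v p) ∙ braid _ _ _
      end
  end.

Lemma extractinv_extract C u p : extractinv C u p ∙ extract C u p = 𝟙.
Proof.
  induction u; cbn; split_pos; auto using rho_inv2.
  - rewrite <- comp_assoc, (post2 (alpha_inv1 C _ _ _)), comp_idl, <- tens_comp.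
    now rewrite IHu1, comp_idl, tens_id.
  - rewrite <- comp_assoc, (post2 (braid_invol _ _ _)), comp_idl, <- tens_comp.
    now rewrite IHu2, comp_idl, tens_id.
Qed.

(** Up to extraction, [f] is the identity on the chosen letter tensored with a formal morphism on
    the rest. The letters at [p] and at [smap f p] agree only propositionally, hence the [cast];
    quantifying over all [e] lets composites choose their own identifications. *)
Definition remove_spec C {u v : word (ob C)} (f : smor u v) (p : pos u) : Prop :=
  exists f' : smor (remove u p) (remove v (smap f p)),
  (forall r, remove_inj v _ (smap f' r) = smap f (remove_inj u p r)) /\
  forall e, extract C v (smap f p) ∙ sinterp C f = (cast e ⊗ sinterp C f') ∙ extract C u p.

(** Turns the commuting square of a structure map into the one for its inverse, so that only one
    direction of each isomorphism needs a computation. *)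
Lemma iso_flip {C : SymMonCat} {a b c d : ob C} {y : hom C a c} {x : hom C b d} {f : hom C a b}
  g {F : hom C c d} G :
  x ∙ f = F ∙ y -> f ∙ g = 𝟙 -> G ∙ F = 𝟙 -> y ∙ g = G ∙ x.
Proof.
  intros E Ef EF. rewrite <- (comp_idr C _ _ x), <- Ef, (comp_assoc C _ _ _ _ g f x), E.
  now rewrite <- comp_assoc, comp_assoc, EF, comp_idl.
Qed.

Lemma remove_smor C {u v : word (ob C)} (f : smor u v) p : remove_spec C f p.
Proof.
  revert p; induction f; intros p.
  - exists (s_id _). split; [easy|]. intros e. cbn. now rewrite cast_id, tens_id, comp_idl, comp_idr.
  - destruct (IHf2 p) as (f' & Hf & Ef), (IHf1 (smap f2 p)) as (g' & Hg & Eg).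
    exists (s_comp _ _ _ g' f'). split.
    + intros r. cbn. now rewrite Hg, Hf.
    + intros e. cbn. rewrite comp_assoc, (Eg (eq_sym (letter_smap f1 _))).
      rewrite <- comp_assoc, (Ef (eq_sym (letter_smap f2 _))), comp_assoc, <- tens_comp.
      now erewrite cast_comp.
  - destruct p as [p|p].
    + destruct (IHf1 p) as (f' & Hf & Ef). exists (s_tens _ _ _ _ f' f2). split.
      * intros [r|r]; cbn; auto. now rewrite <- Hf.
      * intros e. cbn. rewrite <- comp_assoc, <- tens_comp, (Ef e), comp_idl.
        rewrite <- (comp_idr C _ _ (sinterp C f2)) at 1.
        now rewrite tens_comp, comp_assoc, alpha_nat, <- comp_assoc.
    + destruct (IHf2 p) as (f' & Hf & Ef). exists (s_tens _ _ _ _ f1 f'). split.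
      * intros [r|r]; cbn; auto. now rewrite <- Hf.
      * intros e. cbn. rewrite <- comp_assoc, <- tens_comp, (Ef e), comp_idl.
        rewrite <- (comp_idr C _ _ (sinterp C f1)) at 1.
        now rewrite tens_comp, comp_assoc, braid_nat, <- comp_assoc.
  - destruct p as [[p|p]|p]; exists (s_alpha _ _ _); (split; [intros r; cbn in r; now split_pos|]);
      intros e; rewrite cast_id; cbn.
    + apply extract_alpha_1.
    + apply extract_alpha_2.
    + apply extract_alpha_3.
  - assert (I : forall t a b c, (idm t ⊗ alphainv a b c) ∙ (idm t ⊗ alpha a b c) = idm (C := C) _).
    { intros. now rewrite <- tens_comp, alpha_inv1, comp_idl, tens_id. }
    destruct p as [p|[p|p]]; exists (s_alphainv _ _ _); (split; [intros r; cbn in r; now split_pos|]);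
      intros e; rewrite cast_id; cbn; (eapply iso_flip; [|apply alpha_inv2|apply I]).
    + apply extract_alpha_1.
    + apply extract_alpha_2.
    + apply extract_alpha_3.
  - destruct p as [[]|p]. exists (s_lambda _). split; [intros r; cbn in r; now split_pos|].
    intros e; rewrite cast_id; cbn. apply extract_lambda.
  - exists (s_lambdainv _). split; [easy|].
    intros e; rewrite cast_id; cbn. eapply iso_flip; [apply extract_lambda|apply lambda_inv2|].
    now rewrite <- tens_comp, lambda_inv1, comp_idl, tens_id.
  - destruct p as [p|[]]. exists (s_rho _). split; [intros r; cbn in r; now split_pos|].
    intros e; rewrite cast_id; cbn. apply extract_rho.
  - exists (s_rhoinv _). split; [easy|].
    intros e; rewrite cast_id; cbn. eapply iso_flip; [apply extract_rho|apply rho_inv2|].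
    now rewrite <- tens_comp, rho_inv1, comp_idl, tens_id.
  - destruct p as [p|p]; exists (s_sigma _ _); (split; [intros r; cbn in r; now split_pos|]);
      intros e; rewrite cast_id; cbn.
    + apply extract_sigma_1.
    + apply extract_sigma_2.
Qed.

Lemma pos_dec {T} (u : word T) : (pos u -> False) \/ exists p : pos u, True.
Proof.
  induction u; cbn.
  - left; easy.
  - right; now exists tt.
  - destruct IHu1 as [h|[p _]]; [|right; now exists (inl p)].
    destruct IHu2 as [k|[p _]]; [|right; now exists (inr p)].
    left; now intros [p|p].
Qed.

Theorem sym_coherence C (u v : word (ob C)) (f g : smor u v) :
  (forall p, smap f p = smap g p) -> sinterp C f = sinterp C g.
Proof.
  remember (wlen u) as n eqn:Hn. revert u v f g Hn.
  induction n as [n IH] using lt_wf_ind; intros u v f g -> H.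
  destruct (pos_dec u) as [h|[p _]].
  - assert (k : pos v -> False) by (intros q; exact (h (smap (sinv f) q))).
    apply (split_mono (collapse C v k) (sinterp C (sinv (scollapse v k)))).
    { rewrite <- sinterp_scollapse. exact (sinv_sinterp C (scollapse v k)). }
    now rewrite !(collapse_nat C _ k h).
  - apply (split_mono _ _ (extractinv_extract C v (smap f p))).
    destruct (remove_smor C f p) as (f' & Hf & Ef), (remove_smor C g p) as (g' & Hg & Eg).
    (* Since [g] sends [p] where [f] does, both remainders acquire the same target and can be
       compared by induction. *)
    revert g' Hg Eg. rewrite <- (H p). intros g' Hg Eg.
    rewrite (Ef (eq_sym (letter_smap f p))), (Eg (eq_sym (letter_smap f p))).
    do 2 f_equal. apply (IH (wlen (remove u p))); [rewrite (remove_wlen u p); lia|reflexivity|].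
    intros r. apply (remove_inj_inj v (smap f p)). now rewrite Hf, Hg.
Qed.

(** * Formal morphisms into a single bubble *)

Fixpoint flat {T} (a : nob T) : word T :=
  match a with
  | nI => wI
  | nPhi w => w
  | nt a b => wt (flat a) (flat b)
  end.

(** Source and target are stuck on [lax]; once it is known, both flatten to [wt u v], which is why
    the match is needed around an identity. *)
Definition flat_m (lax : bool) {T} (u v : word T) :
  smor (flat (if lax then nt (nPhi u) (nPhi v) else nPhi (wt u v)))
       (flat (if lax then nPhi (wt u v) else nt (nPhi u) (nPhi v))) :=
  match lax return smor (flat (if lax then nt (nPhi u) (nPhi v) else nPhi (wt u v)))
       (flat (if lax then nPhi (wt u v) else nt (nPhi u) (nPhi v))) with true => s_id (wt u v) | false => s_id (wt u v) end.

Fixpoint flatten {T lax} {a b : nob T} (f : nmor lax a b) : smor (flat a) (flat b) :=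
  match f with
  | n_id _ _ => s_id _
  | n_comp _ _ _ _ g f => s_comp _ _ _ (flatten g) (flatten f)
  | n_tens _ _ _ _ _ f g => s_tens _ _ _ _ (flatten f) (flatten g)
  | n_alpha _ _ _ _ => s_alpha _ _ _
  | n_alphainv _ _ _ _ => s_alphainv _ _ _
  | n_lambda _ _ => s_lambda _
  | n_lambdainv _ _ => s_lambdainv _
  | n_rho _ _ => s_rho _
  | n_rhoinv _ _ => s_rhoinv _
  | n_sigma _ _ _ => s_sigma _ _
  | n_phi _ _ _ f => f
  | n_i _ => s_id _
  | n_iinv _ => s_id _
  | n_m _ u v => flat_m lax u v
  end.

(** Multiplying out bubbles does not move letters, so occurrences and their bijections can be taken
    from the flattening, and all facts about [smap] carry over. *)
Definition npos {T} (a : nob T) : Type := pos (flat a).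
Definition nmap {T lax} {a b : nob T} (f : nmor lax a b) : npos a -> npos b := smap (flatten f).

Section Lax.
Context {C D : SymMonCat} (F : NormalLaxSMF C D).
Local Notation "⟦ f ⟧" := (linterp F f).

Fixpoint total (a : nob (ob C)) : hom D (lob F a) (lfob F (wev C (flat a))) :=
  match a with
  | nI => eta F
  | nPhi w => 𝟙
  | nt a b => mu F _ _ ∙ (total a ⊗ total b)
  end.

Lemma lfmap_cancel a b (f : hom C a b) g : f ∙ g = 𝟙 -> lfmap F f ∙ lfmap F g = 𝟙.
Proof. intros E. now rewrite <- lfmap_comp, E, lfmap_id. Qed.

(** The axioms [mu_assoc], [mu_unitl], [mu_unitr] and [mu_sym] are this naturality for the outer
    structure maps; [mu_nat] handles tensor products. *)
Lemma total_nat a b (f : nmor true a b) :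
  total b ∙ ⟦f⟧ = lfmap F (sinterp C (flatten f)) ∙ total a.
Proof.
  assert (A : forall a b c, total (nt a (nt b c)) ∙ alpha _ _ _
    = lfmap F (alpha _ _ _) ∙ total (nt (nt a b) c)).
  { clear. intros. cbn.
    rewrite tensr_comp_left, <- !comp_assoc, <- alpha_nat.
    rewrite (post3 (eq_sym (mu_assoc _ _ F _ _ _))), <- !comp_assoc.
    now rewrite <- tensl_comp_left. }
  assert (L : forall a, total a ∙ lambda _ = lfmap F (lambda _) ∙ total (nt nI a)).
  { clear. intros. cbn. rewrite lambda_nat, <- (mu_unitl _ _ F), <- !comp_assoc.
    now rewrite <- tens_comp, comp_idl, comp_idr. }
  assert (R : forall a, total a ∙ rho _ = lfmap F (rho _) ∙ total (nt a nI)).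
  { clear. intros. cbn. rewrite rho_nat, <- (mu_unitr _ _ F), <- !comp_assoc.
    now rewrite <- tens_comp, comp_idl, comp_idr. }
  induction f; cbn [flatten linterp sinterp].
  - now rewrite comp_idr, lfmap_id, comp_idl.
  - now rewrite comp_assoc, IHf1, <- comp_assoc, IHf2, comp_assoc, lfmap_comp.
  - cbn. rewrite <- comp_assoc, <- tens_comp, IHf1, IHf2.
    now rewrite tens_comp, comp_assoc, mu_nat, <- comp_assoc.
  - apply A.
  - eapply iso_flip; [apply A|apply alpha_inv2|apply lfmap_cancel, alpha_inv1].
  - apply L.
  - eapply iso_flip; [apply L|apply lambda_inv2|apply lfmap_cancel, lambda_inv1].
  - apply R.
  - eapply iso_flip; [apply R|apply rho_inv2|apply lfmap_cancel, rho_inv1].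
  - cbn. rewrite <- comp_assoc, <- sigma_nat, !comp_assoc. now rewrite mu_sym.
  - cbn. now rewrite comp_idl, comp_idr.
  - cbn. now rewrite lfmap_id, !comp_idl.
  - cbn. now rewrite lfmap_id, comp_idl, eta_inv2.
  - cbn. now rewrite lfmap_id, tens_id, !comp_idl, comp_idr.
Qed.

Definition bubble (b : nob (ob C)) : Prop := match b with nt _ _ => False | _ => True end.

(** For such [b] the map [total b] has a retraction: it is an identity on [nPhi w], and on [nI] it
    is [eta F], invertible by normality. Equality can therefore be tested after flattening, by
    [sym_coherence]. *)
Lemma coherence_to_bubble a b (f g : nmor true a b) :
  bubble b -> (forall p, nmap f p = nmap g p) -> ⟦f⟧ = ⟦g⟧.
Proof.
  intros Hb H.
  assert (E : exists s, s ∙ total b = 𝟙).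
  { destruct b; cbn in *; [|exists 𝟙; apply comp_idl|easy]. exists (etainv F). apply eta_inv1. }
  destruct E as [s E]. apply (split_mono _ _ E).
  now rewrite !total_nat, (sym_coherence C _ _ (flatten f) (flatten g)).
Qed.

End Lax.

(** * Restriction to a set of letter occurrences *)

Definition compl {X} (P : X -> bool) : X -> bool := fun x => negb (P x).

Fixpoint srestr {T} (u : word T) : (pos u -> bool) -> word T :=
  match u with
  | wI => fun _ => wI
  | wv t => fun P => if P tt then wv t else wI
  | wt u v => fun P => wt (srestr u (fun p => P (inl p))) (srestr v (fun p => P (inr p)))
  end.

Fixpoint srestr_inj {T} (u : word T) : forall P, pos (srestr u P) -> pos u :=
  match u with
  | wI => fun _ r => r
  | wv t => fun P _ => tt
  | wt u v => fun P r =>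
      match r with inl r => inl (srestr_inj u _ r) | inr r => inr (srestr_inj v _ r) end
  end.

(** The predicate lives on the target and is pulled back to the source. With dropped letters
    replaced by units, each structure map then restricts to one of the same kind, and all types
    match by conversion. *)
Fixpoint srestr_map {T} {u v : word T} (f : smor u v) :
  forall P : pos v -> bool, smor (srestr u (fun p => P (smap f p))) (srestr v P) :=
  match f with
  | s_id _ => fun P => s_id _
  | s_comp _ _ _ g f => fun P => s_comp _ _ _ (srestr_map g P) (srestr_map f (fun p => P (smap g p)))
  | s_tens _ _ _ _ f g => fun P =>
      s_tens _ _ _ _ (srestr_map f (fun p => P (inl p))) (srestr_map g (fun p => P (inr p)))
  | s_alpha _ _ _ => fun P => s_alpha _ _ _
  | s_alphainv _ _ _ => fun P => s_alphainv _ _ _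
  | s_lambda _ => fun P => s_lambda _
  | s_lambdainv _ => fun P => s_lambdainv _
  | s_rho _ => fun P => s_rho _
  | s_rhoinv _ => fun P => s_rhoinv _
  | s_sigma _ _ => fun P => s_sigma _ _
  end.

Lemma srestr_map_inj {T} {u v : word T} (f : smor u v) P r :
  srestr_inj v P (smap (srestr_map f P) r) = smap f (srestr_inj u _ r).
Proof.
  induction f; cbn in *; split_pos; cbn; rewrite ?IHf1, ?IHf2; reflexivity.
Qed.

Lemma srestr_inj_inj {T} (u : word T) P r s : srestr_inj u P r = srestr_inj u P s -> r = s.
Proof.
  induction u; cbn in *; intros E.
  - destruct r.
  - destruct (P tt); [now destruct r, s|destruct r].
  - destruct r, s; try discriminate; injection E as E; f_equal; [eapply IHu1, E|eapply IHu2, E].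
Qed.

Lemma srestr_inj_true {T} (u : word T) P r : P (srestr_inj u P r) = true.
Proof.
  induction u; cbn in *.
  - destruct r.
  - now destruct (P tt).
  - destruct r; [apply (IHu1 (fun p => P (inl p)))|apply (IHu2 (fun p => P (inr p)))].
Qed.

Definition s_braid {T} (a b c : word T) : smor (wt a (wt b c)) (wt b (wt a c)) :=
  s_comp _ _ _ (s_alpha _ _ _) (s_comp _ _ _ (s_tens _ _ _ _ (s_sigma _ _) (s_id _)) (s_alphainv _ _ _)).

Definition s_exchange {T} (a b c d : word T) : smor (wt (wt a b) (wt c d)) (wt (wt a c) (wt b d)) :=
  s_comp _ _ _ (s_alphainv _ _ _)
    (s_comp _ _ _ (s_tens _ _ _ _ (s_id _) (s_braid _ _ _)) (s_alpha _ _ _)).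

Fixpoint smerge {T} (u : word T) : forall P, smor (wt (srestr u P) (srestr u (compl P))) u :=
  match u with
  | wI => fun _ => s_lambda _
  | wv t => fun P =>
      match P tt as b return smor (wt (if b then wv t else wI) (if negb b then wv t else wI)) (wv t) with
      | true => s_rho _
      | false => s_lambda _
      end
  | wt u v => fun P =>
      s_comp _ _ _ (s_tens _ _ _ _ (smerge u (fun p => P (inl p))) (smerge v (fun p => P (inr p))))
        (s_exchange _ _ _ _)
  end.

Lemma smerge_pos {T} (u : word T) P r :
  smap (smerge u P) r = match r with inl r => srestr_inj u P r | inr r => srestr_inj u _ r end.
Proof.
  induction u; cbn in *.
  - now split_pos.
  - unfold compl in *; destruct (P tt), r; cbn in *; split_pos;
      match goal with |- ?x = _ => now destruct x end.
  - destruct r as [[r|r]|[r|r]]; cbn; now rewrite ?IHu1, ?IHu2.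
Qed.

(** A bubble that loses all its letters stays a bubble of units, so that [n_phi] and [n_m] restrict
    without case distinctions. Such bubbles are removed later by [ncollapse]. *)
Fixpoint nrestr {T} (a : nob T) : (npos a -> bool) -> nob T :=
  match a with
  | nI => fun _ => nI
  | nPhi w => fun P => nPhi (srestr w P)
  | nt a b => fun P => nt (nrestr a (fun p => P (inl p))) (nrestr b (fun p => P (inr p)))
  end.

Fixpoint nrestr_inj {T} (a : nob T) : forall P, npos (nrestr a P) -> npos a :=
  match a with
  | nI => fun _ r => r
  | nPhi w => fun P => srestr_inj w P
  | nt a b => fun P r =>
      match r with inl r => inl (nrestr_inj a _ r) | inr r => inr (nrestr_inj b _ r) end
  end.

Fixpoint nrestr_map {T} {a b : nob T} (f : nmor true a b) :
  forall P : npos b -> bool, nmor true (nrestr a (fun p => P (nmap f p))) (nrestr b P) :=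
  match f in nmor _ a b return
    forall P : npos b -> bool, nmor true (nrestr a (fun p => P (nmap f p))) (nrestr b P) with
  | n_id _ _ => fun P => n_id _ _
  | n_comp _ _ _ _ g f => fun P =>
      n_comp _ _ _ _ (nrestr_map g P) (nrestr_map f (fun p => P (nmap g p)))
  | n_tens _ _ _ _ _ f g => fun P =>
      n_tens _ _ _ _ _ (nrestr_map f (fun p => P (inl p))) (nrestr_map g (fun p => P (inr p)))
  | n_alpha _ _ _ _ => fun P => n_alpha _ _ _ _
  | n_alphainv _ _ _ _ => fun P => n_alphainv _ _ _ _
  | n_lambda _ _ => fun P => n_lambda _ _
  | n_lambdainv _ _ => fun P => n_lambdainv _ _
  | n_rho _ _ => fun P => n_rho _ _
  | n_rhoinv _ _ => fun P => n_rhoinv _ _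
  | n_sigma _ _ _ => fun P => n_sigma _ _ _
  | n_phi _ _ _ f => fun P => n_phi _ _ _ (srestr_map f P)
  | n_i _ => fun P => n_i _
  | n_iinv _ => fun P => n_iinv _
  | n_m _ u v => fun P => n_m _ _ _
  end.

Lemma nrestr_map_inj {T} {a b : nob T} (f : nmor true a b) P r :
  nrestr_inj b P (nmap (nrestr_map f P) r) = nmap f (nrestr_inj a _ r).
Proof.
  induction f; unfold npos, nmap in *; cbn in *; split_pos; cbn; rewrite ?IHf1, ?IHf2; try reflexivity.
  apply srestr_map_inj.
Qed.

Lemma nrestr_inj_inj {T} (a : nob T) P r s : nrestr_inj a P r = nrestr_inj a P s -> r = s.
Proof.
  induction a; unfold npos in *; cbn in *; intros E.
  - destruct r.
  - eapply srestr_inj_inj, E.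
  - destruct r, s; try discriminate; injection E as E; f_equal; [eapply IHa1, E|eapply IHa2, E].
Qed.

Lemma nrestr_inj_true {T} (a : nob T) P r : P (nrestr_inj a P r) = true.
Proof.
  induction a; unfold npos in *; cbn in *.
  - destruct r.
  - apply srestr_inj_true.
  - destruct r; [apply (IHa1 (fun p => P (inl p)))|apply (IHa2 (fun p => P (inr p)))].
Qed.

Definition n_braid {T} (a b c : nob T) : nmor true (nt a (nt b c)) (nt b (nt a c)) :=
  n_comp _ _ _ _ (n_alpha _ _ _ _)
    (n_comp _ _ _ _ (n_tens _ _ _ _ _ (n_sigma _ _ _) (n_id _ _)) (n_alphainv _ _ _ _)).

Definition n_exchange {T} (a b c d : nob T) : nmor true (nt (nt a b) (nt c d)) (nt (nt a c) (nt b d)) :=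
  n_comp _ _ _ _ (n_alphainv _ _ _ _)
    (n_comp _ _ _ _ (n_tens _ _ _ _ _ (n_id _ _) (n_braid _ _ _)) (n_alpha _ _ _ _)).

Fixpoint nmerge {T} (a : nob T) : forall P, nmor true (nt (nrestr a P) (nrestr a (compl P))) a :=
  match a with
  | nI => fun _ => n_lambda _ _
  | nPhi w => fun P => n_comp _ _ _ _ (n_phi _ _ _ (smerge w P)) (n_m true _ _)
  | nt a b => fun P =>
      n_comp _ _ _ _ (n_tens _ _ _ _ _ (nmerge a (fun p => P (inl p))) (nmerge b (fun p => P (inr p))))
        (n_exchange _ _ _ _)
  end.

Lemma nmerge_pos {T} (a : nob T) P r :
  nmap (nmerge a P) r = match r with inl r => nrestr_inj a P r | inr r => nrestr_inj a _ r end.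
Proof.
  induction a; unfold npos, nmap in *; cbn in *.
  - now split_pos.
  - apply smerge_pos.
  - destruct r as [[r|r]|[r|r]]; cbn; now rewrite ?IHa1, ?IHa2.
Qed.

(** * Merging two complementary restrictions *)

Section Exchange.
Context {D : SymMonCat}.
Implicit Types a b c d : ob D.

(** Both sides lift to formal morphisms on single letters with the same bijection, so
    [sym_coherence] applies; the next four lemmas go the same way. Together they make the tensor
    product a strong symmetric monoidal functor with comparison [exchange]. *)
Lemma exchange_invol a b c d : exchange a b c d ∙ exchange a c b d = 𝟙.
Proof.
  apply (sym_coherence D _ _
    (s_comp _ _ _ (s_exchange (wv a) (wv b) (wv c) (wv d)) (s_exchange _ _ _ _)) (s_id _)).
  intros p; cbn in p; now split_pos.
Qed.

Lemma exchange_alpha a b c a' b' c' :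
  alpha (a ⊠ a') (b ⊠ b') (c ⊠ c') ∙ (exchange a b a' b' ⊗ 𝟙) ∙ exchange (a ⊠ b) c (a' ⊠ b') c'
  = (𝟙 ⊗ exchange b c b' c') ∙ exchange a (b ⊠ c) a' (b' ⊠ c') ∙ (alpha a b c ⊗ alpha a' b' c').
Proof.
  apply (sym_coherence D _ _
    (s_comp _ _ _ (s_alpha (wt (wv a) (wv a')) (wt (wv b) (wv b')) (wt (wv c) (wv c')))
      (s_comp _ _ _ (s_tens _ _ _ _ (s_exchange (wv a) (wv b) _ _) (s_id _))
        (s_exchange (wt (wv a) (wv b)) (wv c) (wt (wv a') (wv b')) (wv c'))))
    (s_comp _ _ _ (s_tens _ _ _ _ (s_id _) (s_exchange (wv b) (wv c) _ _))
      (s_comp _ _ _ (s_exchange (wv a) (wt (wv b) (wv c)) (wv a') (wt (wv b') (wv c')))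
        (s_tens _ _ _ _ (s_alpha _ _ _) (s_alpha _ _ _))))).
  intros p; cbn in p; now split_pos.
Qed.

Lemma exchange_lambda a b :
  lambda (a ⊠ b) ∙ (lambda unit ⊗ 𝟙) ∙ exchange unit a unit b = lambda a ⊗ lambda b.
Proof.
  apply (sym_coherence D _ _
    (s_comp _ _ _ (s_lambda (wt (wv a) (wv b)))
      (s_comp _ _ _ (s_tens _ _ _ _ (s_lambda wI) (s_id _)) (s_exchange wI (wv a) wI (wv b))))
    (s_tens _ _ _ _ (s_lambda _) (s_lambda _))).
  intros p; cbn in p; now split_pos.
Qed.

Lemma exchange_rho a b :
  rho (a ⊠ b) ∙ (𝟙 ⊗ lambda unit) ∙ exchange a unit b unit = rho a ⊗ rho b.
Proof.
  apply (sym_coherence D _ _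
    (s_comp _ _ _ (s_rho (wt (wv a) (wv b)))
      (s_comp _ _ _ (s_tens _ _ _ _ (s_id _) (s_lambda wI)) (s_exchange (wv a) wI (wv b) wI)))
    (s_tens _ _ _ _ (s_rho _) (s_rho _))).
  intros p; cbn in p; now split_pos.
Qed.

Lemma exchange_sigma a b c d :
  sigma (a ⊠ c) (b ⊠ d) ∙ exchange a b c d = exchange b a d c ∙ (sigma a b ⊗ sigma c d).
Proof.
  apply (sym_coherence D _ _
    (s_comp _ _ _ (s_sigma (wt (wv a) (wv c)) (wt (wv b) (wv d))) (s_exchange _ _ _ _))
    (s_comp _ _ _ (s_exchange (wv b) (wv a) (wv d) (wv c)) (s_tens _ _ _ _ (s_sigma _ _) (s_sigma _ _)))).
  intros p; cbn in p; now split_pos.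
Qed.

Section Merge.
Context {a a' a'' b b' b'' c c' c'' : ob D}.
Context (f : hom D (a' ⊠ a'') a) (g : hom D (b' ⊠ b'') b) (h : hom D (c' ⊠ c'') c).

(** With [f], [g], [h] in the role of the merges of three factors, the squares of this section give
    the naturality of merging along the structure maps outside bubbles. *)
Lemma exchange_merge_alpha :
  ((f ⊗ ((g ⊗ h) ∙ exchange b' c' b'' c'')) ∙ exchange a' (b' ⊠ c') a'' (b'' ⊠ c''))
    ∙ (alpha a' b' c' ⊗ alpha a'' b'' c'')
  = alpha a b c
    ∙ ((((f ⊗ g) ∙ exchange a' b' a'' b'') ⊗ h) ∙ exchange (a' ⊠ b') c' (a'' ⊠ b'') c'').
Proof.
  rewrite <- (comp_idr D _ _ f) at 1. rewrite <- (comp_idr D _ _ h) at 2.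
  rewrite !tens_comp, <- !comp_assoc, <- exchange_alpha.
  now rewrite (comp_assoc D _ _ _ _ _ (_ ⊗ h) (alpha a b c)), alpha_nat, <- !comp_assoc.
Qed.

Lemma exchange_merge_alphainv :
  alphainv a b c ∙ ((f ⊗ ((g ⊗ h) ∙ exchange b' c' b'' c'')) ∙ exchange a' (b' ⊠ c') a'' (b'' ⊠ c''))
  = ((((f ⊗ g) ∙ exchange a' b' a'' b'') ⊗ h) ∙ exchange (a' ⊠ b') c' (a'' ⊠ b'') c'')
    ∙ (alphainv a' b' c' ⊗ alphainv a'' b'' c'').
Proof.
  symmetry. eapply iso_flip; [apply exchange_merge_alpha| |apply alpha_inv1].
  now rewrite <- tens_comp, !alpha_inv2, tens_id.
Qed.

Lemma exchange_merge_lambda :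
  f ∙ (lambda a' ⊗ lambda a'')
  = lambda a ∙ ((lambda unit ⊗ f) ∙ exchange unit a' unit a'').
Proof.
  rewrite <- exchange_lambda, <- (comp_idl D _ _ (lambda unit)) at 1.
  rewrite <- (comp_idl D _ _ (lambda unit)) at 2. rewrite <- (comp_idr D _ _ f) at 2.
  now rewrite tens_comp, <- comp_assoc, comp_assoc, lambda_nat, <- comp_assoc, comp_idl.
Qed.

Lemma exchange_merge_lambdainv :
  lambdainv a ∙ f = ((lambda unit ⊗ f) ∙ exchange unit a' unit a'') ∙ (lambdainv a' ⊗ lambdainv a'').
Proof.
  symmetry. eapply iso_flip; [apply exchange_merge_lambda| |apply lambda_inv1].
  now rewrite <- tens_comp, !lambda_inv2, tens_id.
Qed.

Lemma exchange_merge_rho :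
  f ∙ (rho a' ⊗ rho a'')
  = rho a ∙ ((f ⊗ lambda unit) ∙ exchange a' unit a'' unit).
Proof.
  rewrite <- exchange_rho.
  rewrite <- (comp_idl D _ _ (lambda unit)) at 2. rewrite <- (comp_idr D _ _ f) at 2.
  now rewrite tens_comp, <- comp_assoc, comp_assoc, rho_nat, <- comp_assoc.
Qed.

Lemma exchange_merge_rhoinv :
  rhoinv a ∙ f = ((f ⊗ lambda unit) ∙ exchange a' unit a'' unit) ∙ (rhoinv a' ⊗ rhoinv a'').
Proof.
  symmetry. eapply iso_flip; [apply exchange_merge_rho| |apply rho_inv1].
  now rewrite <- tens_comp, !rho_inv2, tens_id.
Qed.

Lemma exchange_merge_sigma :
  sigma a b ∙ ((f ⊗ g) ∙ exchange a' b' a'' b'')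
  = ((g ⊗ f) ∙ exchange b' a' b'' a'') ∙ (sigma a' b' ⊗ sigma a'' b'').
Proof. now rewrite comp_assoc, sigma_nat, <- !comp_assoc, exchange_sigma. Qed.

Lemma exchange_merge_epi s t : f ∙ s = 𝟙 -> g ∙ t = 𝟙 ->
  ((f ⊗ g) ∙ exchange a' b' a'' b'') ∙ (exchange a' a'' b' b'' ∙ (s ⊗ t)) = 𝟙.
Proof.
  intros E E'. rewrite <- comp_assoc, (post2 (exchange_invol _ _ _ _)), comp_idl.
  now rewrite <- tens_comp, E, E', tens_id.
Qed.

End Merge.

Lemma exchange_merge_tens {a b c d a1 a2 b1 b2 c1 c2 d1 d2}
  (f : hom D a b) (m : hom D (a1 ⊠ a2) a) (n : hom D (b1 ⊠ b2) b) f1 f2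
  (g : hom D c d) (k : hom D (c1 ⊠ c2) c) (l : hom D (d1 ⊠ d2) d) g1 g2 :
  f ∙ m = n ∙ (f1 ⊗ f2) -> g ∙ k = l ∙ (g1 ⊗ g2) ->
  (f ⊗ g) ∙ ((m ⊗ k) ∙ exchange _ _ _ _)
  = ((n ⊗ l) ∙ exchange _ _ _ _) ∙ ((f1 ⊗ g1) ⊗ (f2 ⊗ g2)).
Proof.
  intros E E'. now rewrite comp_assoc, <- tens_comp, E, E', tens_comp, <- !comp_assoc, exchange_nat.
Qed.


End Exchange.

(** * Restrictions that never cut through a bubble *)

Fixpoint pure {T} (a : nob T) : (npos a -> bool) -> Prop :=
  match a with
  | nI => fun _ => True
  | nPhi w => fun P => (forall p, P p = true) \/ (forall p, P p = false)
  | nt a b => fun P => pure a (fun p => P (inl p)) /\ pure b (fun p => P (inr p))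
  end.

Lemma pure_const {T} (a : nob T) c : pure a (fun _ => c).
Proof. induction a; cbn; auto. destruct c; auto. Qed.

(** This is where the direction of [n_m] matters: lax formal morphisms fuse bubbles but never split
    them, so the letters of one source bubble end up in one target bubble. *)
Lemma pure_nmap {T} {a b : nob T} (f : nmor true a b) P : pure b P -> pure a (fun p => P (nmap f p)).
Proof.
  induction f; unfold npos, nmap in *; cbn in *; try (intuition; fail).
  - intros H. apply (IHf2 (fun p => P (smap (flatten f1) p))), IHf1, H.
  - intros [H K]. split; [apply (IHf1 (fun p => P (inl p))), H|apply (IHf2 (fun p => P (inr p))), K].
Qed.

(** The restricted word equals [w], but only propositionally; a formal morphism between them avoids
    transport. *)
Lemma srestr_keep {T} (w : word T) P : (forall p, P p = true) ->
  exists k : smor w (srestr w P), forall p, srestr_inj w P (smap k p) = p.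
Proof.
  induction w; cbn; intros H.
  - now exists (s_id _).
  - rewrite (H tt). exists (s_id _). intros q. now destruct q.
  - destruct (IHw1 _ (fun p => H (inl p))) as [k Hk], (IHw2 _ (fun p => H (inr p))) as [l Hl].
    exists (s_tens _ _ _ _ k l). intros [p|p]; cbn; [now rewrite Hk|now rewrite Hl].
Qed.

Lemma srestr_empty {T} (w : word T) P : (forall p, P p = false) -> pos (srestr w P) -> False.
Proof. intros H r. generalize (srestr_inj_true w P r). now rewrite H. Qed.

Lemma nrestr_empty {T} (a : nob T) P : (forall p, P p = false) -> npos (nrestr a P) -> False.
Proof. intros H r. generalize (nrestr_inj_true a P r). now rewrite H. Qed.

(** The measure for the main induction: it drops from a tensor product to its factors and, by
    [tensors_nrestr], is unaffected by restriction. *)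
Fixpoint tensors {T} (a : nob T) : nat :=
  match a with nt a b => S (tensors a + tensors b) | _ => 0 end.

Lemma tensors_nrestr {T} (a : nob T) P : tensors (nrestr a P) = tensors a.
Proof. induction a; cbn; auto. Qed.

(** * Coherence for normal lax functors *)

Section Lax.
Context {C D : SymMonCat} (F : NormalLaxSMF C D).
Local Notation "⟦ f ⟧" := (linterp F f).

Lemma nmerge_nat a b (f : nmor true a b) P :
  ⟦f⟧ ∙ ⟦nmerge a (fun p => P (nmap f p))⟧
  = ⟦nmerge b P⟧ ∙ (⟦nrestr_map f P⟧ ⊗ ⟦nrestr_map f (compl P)⟧).
Proof.
  (* The generators [n_phi], [n_i], [n_iinv] and [n_m] all end in a bubble or in [nI]. Both sides
     being formal, it suffices there to compare bijections. *)
  assert (B : forall a b (f : nmor true a b) P, bubble b ->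
    ⟦f⟧ ∙ ⟦nmerge a (fun p => P (nmap f p))⟧
    = ⟦nmerge b P⟧ ∙ (⟦nrestr_map f P⟧ ⊗ ⟦nrestr_map f (compl P)⟧)).
  { clear. intros a b f P Hb.
    apply (coherence_to_bubble F _ _ (n_comp _ _ _ _ f (nmerge a (fun p => P (nmap f p))))
      (n_comp _ _ _ _ (nmerge b P) (n_tens _ _ _ _ _ (nrestr_map f P) (nrestr_map f (compl P)))) Hb).
    intros p. change (nmap f (nmap (nmerge a (fun p => P (nmap f p))) p)
      = nmap (nmerge b P) (match p with inl p => inl (nmap (nrestr_map f P) p)
          | inr p => inr (nmap (nrestr_map f (compl P)) p) end)).
    rewrite !nmerge_pos. destruct p; now rewrite nrestr_map_inj. }
  induction f.
  - cbn. now rewrite tens_id, comp_idl, comp_idr.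
  - specialize (IHf1 P). specialize (IHf2 (fun p => P (nmap f1 p))).
    change (⟦n_comp _ _ _ _ f1 f2⟧) with (⟦f1⟧ ∙ ⟦f2⟧).
    rewrite <- comp_assoc. etransitivity; [apply f_equal, IHf2|].
    rewrite comp_assoc, IHf1, <- comp_assoc. cbn. now rewrite tens_comp.
  - exact (exchange_merge_tens _ _ _ _ _ _ _ _ _ _
      (IHf1 (fun p => P (inl p))) (IHf2 (fun p => P (inr p)))).
  - exact (eq_sym (exchange_merge_alpha ⟦nmerge a _⟧ ⟦nmerge b _⟧ ⟦nmerge c _⟧)).
  - exact (exchange_merge_alphainv ⟦nmerge a _⟧ ⟦nmerge b _⟧ ⟦nmerge c _⟧).
  - exact (eq_sym (exchange_merge_lambda ⟦nmerge a _⟧)).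
  - exact (exchange_merge_lambdainv ⟦nmerge a _⟧).
  - exact (eq_sym (exchange_merge_rho ⟦nmerge a _⟧)).
  - exact (exchange_merge_rhoinv ⟦nmerge a _⟧).
  - exact (exchange_merge_sigma ⟦nmerge a _⟧ ⟦nmerge b _⟧).
  - now apply B.
  - now apply B.
  - now apply B.
  - now apply B.
Qed.

(** On a bubble kept whole by one restriction, the other restriction is letterless: the section
    inserts a unit and expands it into that bubble through [n_i]. This section is itself formal, so
    [coherence_to_bubble] verifies it. Tensor products use that [exchange] is invertible. *)
Lemma nmerge_epi a P : pure a P -> exists s, ⟦nmerge a P⟧ ∙ s = 𝟙.
Proof.
  induction a; intros H.
  - exists (lambdainv _). apply lambda_inv2.
  - destruct H as [H|H].
    + destruct (srestr_keep w P H) as [k Hk].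
      assert (e : pos (srestr w (compl P)) -> False).
      { apply srestr_empty. intros p. unfold compl. now rewrite (H p). }
      set (s := n_comp true _ _ _ (n_tens _ _ _ _ _ (n_phi _ _ _ k)
        (n_comp _ _ _ _ (n_phi _ _ _ (sinv (scollapse _ e))) (n_i _))) (n_rhoinv _ _)).
      exists ⟦s⟧. apply (coherence_to_bubble F _ _ (n_comp _ _ _ _ (nmerge (nPhi w) P) s) (n_id _ _) I).
      intros p. etransitivity; [apply (nmerge_pos (nPhi w) P (inl (smap k p)))|apply Hk].
    + destruct (srestr_keep w (compl P)) as [k Hk].
      { intros p. unfold compl. now rewrite (H p). }
      assert (e : pos (srestr w P) -> False) by (now apply srestr_empty).
      set (s := n_comp true _ _ _ (n_tens _ _ _ _ _
        (n_comp _ _ _ _ (n_phi _ _ _ (sinv (scollapse _ e))) (n_i _)) (n_phi _ _ _ k)) (n_lambdainv _ _)).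
      exists ⟦s⟧. apply (coherence_to_bubble F _ _ (n_comp _ _ _ _ (nmerge (nPhi w) P) s) (n_id _ _) I).
      intros p. etransitivity; [apply (nmerge_pos (nPhi w) P (inr (smap k p)))|apply Hk].
  - destruct H as [H1 H2], (IHa1 _ H1) as [s1 E1], (IHa2 _ H2) as [s2 E2].
    exists (exchange _ _ _ _ ∙ (s1 ⊗ s2)).
    exact (exchange_merge_epi ⟦nmerge a1 _⟧ ⟦nmerge a2 _⟧ _ _ E1 E2).
Qed.

(** A letterless bubble is isomorphic to [nPhi wI], and normality, through [n_iinv], identifies the
    latter with [nI]. *)
Lemma ncollapse a : (npos a -> False) -> exists (k : nmor true a nI) s, s ∙ ⟦k⟧ = 𝟙.
Proof.
  induction a; intros h.
  - exists (n_id _ _), 𝟙. apply comp_idl.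
  - exists (n_comp _ _ _ _ (n_iinv _) (n_phi _ _ _ (scollapse w h))).
    exists (lfmap F (sinterp C (sinv (scollapse w h))) ∙ eta F). cbn.
    rewrite <- comp_assoc, (post2 (eta_inv2 _ _ F)), comp_idl, <- lfmap_id, <- lfmap_comp.
    f_equal. exact (sinv_sinterp C (scollapse w h)).
  - destruct (IHa1 (fun p => h (inl p))) as (k1 & s1 & E1), (IHa2 (fun p => h (inr p))) as (k2 & s2 & E2).
    exists (n_comp _ _ _ _ (n_lambda _ _) (n_tens _ _ _ _ _ k1 k2)), ((s1 ⊗ s2) ∙ lambdainv _). cbn in *.
    now rewrite <- comp_assoc, (post2 (lambda_inv1 _ _)), comp_idl, <- tens_comp, E1, E2, tens_id.
Qed.

(** Two morphisms with the same bijection pull [P] back to predicates that are pointwise equal but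
    not convertible. Allowing any such [Q] puts both restrictions over the same source. *)
Lemma restriction_exists a b (f : nmor true a b) P Q :
  (forall p, Q p = P (nmap f p)) ->
  exists (f1 : nmor true (nrestr a Q) (nrestr b P))
         (f2 : nmor true (nrestr a (compl Q)) (nrestr b (compl P))),
  (forall r, nrestr_inj b _ (nmap f1 r) = nmap f (nrestr_inj a _ r)) /\
  (forall r, nrestr_inj b _ (nmap f2 r) = nmap f (nrestr_inj a _ r)) /\
  ⟦f⟧ ∙ ⟦nmerge a Q⟧ = ⟦nmerge b P⟧ ∙ (⟦f1⟧ ⊗ ⟦f2⟧).
Proof.
  intros H. replace Q with (fun p => P (nmap f p)) by (symmetry; now apply functional_extensionality).
  exists (nrestr_map f P), (nrestr_map f (compl P)).
  split; [|split]; [apply nrestr_map_inj|apply (nrestr_map_inj f (compl P))|apply nmerge_nat].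
Qed.

Theorem lax_coherence a b (f g : nmor true a b) :
  (forall p, nmap f p = nmap g p) -> ⟦f⟧ = ⟦g⟧.
Proof.
  remember (tensors b) as n eqn:Hn. revert a b f g Hn.
  induction n as [n IH] using lt_wf_ind; intros a b f g -> H.
  destruct b as [|w|b1 b2]; [now apply coherence_to_bubble..|].
  (* [P] selects the letters that end up in [b1]; it is constant on each factor, hence pure, and so
     is its pullback [Q]. *)
  set (P := fun p : npos (nt b1 b2) => match p with inl _ => true | inr _ => false end).
  set (Q := fun p => P (nmap f p)).
  assert (HQ : pure a Q) by (apply pure_nmap; exact (conj (pure_const b1 true) (pure_const b2 false))).
  destruct (nmerge_epi a Q HQ) as [s Es]. apply (split_epi _ s Es). clear HQ s Es.
  destruct (restriction_exists a _ f P Q) as (f1 & f2 & Hf1 & Hf2 & Ef); [easy|].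
  destruct (restriction_exists a _ g P Q) as (g1 & g2 & Hg1 & Hg2 & Eg).
  { intros p. unfold Q. now rewrite H. }
  assert (H1 : forall r, nmap f1 r = nmap g1 r).
  { intros r. apply (nrestr_inj_inj (nt b1 b2) P). now rewrite Hf1, Hg1. }
  assert (H2 : forall r, nmap f2 r = nmap g2 r).
  { intros r. apply (nrestr_inj_inj (nt b1 b2) (compl P)). now rewrite Hf2, Hg2. }
  rewrite Ef, Eg. do 2 f_equal.
  (* The target of [f1] is [nt c e] with [e] letterless. Absorbing [e] by the split mono [K] leaves
     the target [c], which has as many tensors as [b1]; the other half is symmetric. *)
  - set (c := nrestr b1 (fun _ => true)). set (e := nrestr b2 (fun _ => false)).
    destruct (ncollapse e) as (k & s & E); [now apply nrestr_empty|].
    set (K := n_comp true _ _ _ (n_rho true c) (n_tens _ _ _ _ _ (n_id _ c) k)).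
    apply (split_mono ⟦K⟧ ((𝟙 ⊗ s) ∙ rhoinv _)).
    { cbn in *. now rewrite <- comp_assoc, (post2 (rho_inv1 _ _)), comp_idl, <- tens_comp,
        E, comp_idl, tens_id. }
    apply (IH (tensors b1)) with (f := n_comp _ _ _ _ K f1) (g := n_comp _ _ _ _ K g1).
    + cbn. lia.
    + symmetry. apply tensors_nrestr.
    + intros r. exact (f_equal (nmap K) (H1 r)).
  - set (c := nrestr b2 (fun _ => true)). set (e := nrestr b1 (fun _ => false)).
    destruct (ncollapse e) as (k & s & E); [now apply nrestr_empty|].
    set (K := n_comp true _ _ _ (n_lambda true c) (n_tens _ _ _ _ _ k (n_id _ c))).
    apply (split_mono ⟦K⟧ ((s ⊗ 𝟙) ∙ lambdainv _)).
    { cbn in *. now rewrite <- comp_assoc, (post2 (lambda_inv1 _ _)), comp_idl, <- tens_comp,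
        E, comp_idl, tens_id. }
    apply (IH (tensors b2)) with (f := n_comp _ _ _ _ K f2) (g := n_comp _ _ _ _ K g2).
    + cbn. lia.
    + symmetry. apply tensors_nrestr.
    + intros r. exact (f_equal (nmap K) (H2 r)).
Qed.

End Lax.

(** * Normal oplax functors, by duality *)

Lemma lambdainv_nat {C : SymMonCat} {a b : ob C} (f : hom C a b) :
  lambdainv b ∙ f = (𝟙 ⊗ f) ∙ lambdainv a.
Proof. symmetry. eapply iso_flip; [apply lambda_nat|apply lambda_inv2|apply lambda_inv1]. Qed.

Lemma rhoinv_nat {C : SymMonCat} {a b : ob C} (f : hom C a b) :
  rhoinv b ∙ f = (f ⊗ 𝟙) ∙ rhoinv a.
Proof. symmetry. eapply iso_flip; [apply rho_nat|apply rho_inv2|apply rho_inv1]. Qed.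

(** Kept transparent, so that morphisms of [opp C] convert to morphisms of [C] in the statements
    below. *)
Definition opp (C : SymMonCat) : SymMonCat.
Proof.
  refine {|
    ob := ob C; hom a b := hom C b a; idm a := idm a; comp a b c g f := comp f g;
    tens a b := tens a b; tensm a b c d f g := tensm f g; Defs.unit := unit;
    alpha a b c := alphainv a b c; alphainv a b c := alpha a b c;
    lambda a := lambdainv a; lambdainv a := lambda a; rho a := rhoinv a; rhoinv a := rho a;
    sigma a b := sigma b a |}; intros.
  - symmetry. apply comp_assoc.
  - apply comp_idr.
  - apply comp_idl.
  - apply tens_id.
  - apply tens_comp.
  - symmetry. apply alphainv_nat.
  - apply alpha_inv1.
  - apply alpha_inv2.
  - apply lambdainv_nat.
  - apply lambda_inv1.
  - apply lambda_inv2.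
  - apply rhoinv_nat.
  - apply rho_inv1.
  - apply rho_inv2.
  - symmetry. apply sigma_nat.
  - apply sigma_invol.
  (* The reversed pentagon, triangle and hexagon are equations between formal morphisms, hence
     instances of coherence. *)
  - apply (sym_coherence C _ _
      (s_comp _ _ _ (s_alphainv (wt (wv a) (wv b)) (wv c) (wv d)) (s_alphainv (wv a) (wv b) _))
      (s_comp _ _ _ (s_comp _ _ _ (s_tens _ _ _ _ (s_alphainv (wv a) (wv b) (wv c)) (s_id _))
        (s_alphainv _ _ _)) (s_tens _ _ _ _ (s_id _) (s_alphainv _ _ _)))).
    intros p; cbn in p; now split_pos.
  - apply (sym_coherence C _ _
      (s_comp _ _ _ (s_alphainv (wv a) wI (wv b)) (s_tens _ _ _ _ (s_id _) (s_lambdainv _)))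
      (s_tens _ _ _ _ (s_rhoinv (wv a)) (s_id (wv b)))).
    intros p; cbn in p; now split_pos.
  - apply (sym_coherence C _ _
      (s_comp _ _ _ (s_comp _ _ _ (s_alphainv (wv a) (wv b) (wv c)) (s_sigma _ _)) (s_alphainv _ _ _))
      (s_comp _ _ _ (s_comp _ _ _ (s_tens _ _ _ _ (s_sigma (wv b) (wv a)) (s_id _)) (s_alphainv _ _ _))
        (s_tens _ _ _ _ (s_id _) (s_sigma (wv c) (wv a))))).
    intros p; cbn in p; now split_pos.
Defined.

Definition opp_functor {C D : SymMonCat} (F : NormalOplaxSMF C D) : NormalLaxSMF (opp C) (opp D).
Proof.
  refine {|
    lfob := ofob F : ob (opp C) -> ob (opp D); lfmap a b f := ofmap F f;
    mu a b := delta F a b; eta := eps F; etainv := epsinv F |}; intros.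
  - apply (ofmap_id _ _ F).
  - apply (ofmap_comp _ _ F).
  - apply (delta_nat _ _ F).
  - cbn. etransitivity; [eapply iso_flip|apply comp_assoc].
    + rewrite <- comp_assoc. symmetry. apply (delta_assoc _ _ F).
    + rewrite <- ofmap_comp, alpha_inv2. apply ofmap_id.
    + apply alpha_inv1.
  (* Filling in an identity as the fourth side turns the unit triangle into a square that [iso_flip]
     can invert. *)
  - cbn. etransitivity; [eapply (iso_flip (x := 𝟙))|apply comp_idr].
    + rewrite comp_idl. symmetry. apply (delta_unitl _ _ F).
    + rewrite <- ofmap_comp, lambda_inv2. apply ofmap_id.
    + apply lambda_inv1.
  - cbn. etransitivity; [eapply (iso_flip (x := 𝟙))|apply comp_idr].
    + rewrite comp_idl. symmetry. apply (delta_unitr _ _ F).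
    + rewrite <- ofmap_comp, rho_inv2. apply ofmap_id.
    + apply rho_inv1.
  - symmetry. apply (delta_sym _ _ F b a).
  - apply (eps_inv2 _ _ F).
  - apply (eps_inv1 _ _ F).
Defined.

(** Each generator goes to the one that means the original in the opposite categories: [alphainv] of
    [opp D] is [alpha] of [D], and the lax comparison of [opp_functor F] is [delta F]. *)
Fixpoint nrev {T} {a b : nob T} (f : nmor false a b) : nmor true b a :=
  match f in nmor _ a b return nmor true b a with
  | n_id _ _ => n_id _ _
  | n_comp _ _ _ _ g f => n_comp _ _ _ _ (nrev f) (nrev g)
  | n_tens _ _ _ _ _ f g => n_tens _ _ _ _ _ (nrev f) (nrev g)
  | n_alpha _ _ _ _ => n_alphainv _ _ _ _
  | n_alphainv _ _ _ _ => n_alpha _ _ _ _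
  | n_lambda _ _ => n_lambdainv _ _
  | n_lambdainv _ _ => n_lambda _ _
  | n_rho _ _ => n_rhoinv _ _
  | n_rhoinv _ _ => n_rho _ _
  | n_sigma _ _ _ => n_sigma _ _ _
  | n_phi _ _ _ f => n_phi _ _ _ (sinv f)
  | n_i _ => n_iinv _
  | n_iinv _ => n_i _
  | n_m _ u v => n_m true u v
  end.

Lemma flatten_nrev {T} {a b : nob T} (f : nmor false a b) : flatten (nrev f) = sinv (flatten f).
Proof. induction f; cbn; rewrite ?IHf1, ?IHf2; reflexivity. Qed.

Lemma nmap_nrev {T} {a b : nob T} (f g : nmor false a b) :
  (forall p, nmap f p = nmap g p) -> forall q, nmap (nrev f) q = nmap (nrev g) q.
Proof.
  unfold nmap. intros H q. rewrite !flatten_nrev.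
  rewrite <- (sinv_smap (flatten g) (smap (sinv (flatten f)) q)).
  now rewrite <- H, smap_sinv.
Qed.

(** This agreement needs induction and is not a conversion, so interpretations over [C] and [opp C]
    have different hom types; they are compared below by [JMeq]. *)
Lemma wev_opp C w : wev (opp C) w = wev C w.
Proof. induction w; [reflexivity..|exact (f_equal2 (@tens C) IHw1 IHw2)]. Qed.

Lemma lob_opp {C D} (F : NormalOplaxSMF C D) a : lob (opp_functor F) a = oob F a.
Proof.
  induction a; [reflexivity|exact (f_equal (ofob F) (wev_opp C _))|exact (f_equal2 (@tens D) IHa1 IHa2)].
Qed.

Section JMeq.
Context {C : SymMonCat}.
Implicit Types a b c d : ob C.

Lemma JMeq_comp a b c a' b' c' (g : hom C b c) (f : hom C a b) (g' : hom C b' c') (f' : hom C a' b') :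
  a = a' -> b = b' -> c = c' -> JMeq g g' -> JMeq f f' -> JMeq (g ∙ f) (g' ∙ f').
Proof. intros -> -> -> E E'. now rewrite (JMeq_eq E), (JMeq_eq E'). Qed.

Lemma JMeq_tens a b c d a' b' c' d' (f : hom C a b) (g : hom C c d) (f' : hom C a' b') (g' : hom C c' d') :
  a = a' -> b = b' -> c = c' -> d = d' -> JMeq f f' -> JMeq g g' -> JMeq (f ⊗ g) (f' ⊗ g').
Proof. intros -> -> -> -> E E'. now rewrite (JMeq_eq E), (JMeq_eq E'). Qed.

End JMeq.

Lemma JMeq_app {X} {P : X -> Type} (h : forall x, P x) x x' : x = x' -> JMeq (h x) (h x').
Proof. now intros ->. Qed.

Lemma JMeq_app2 {X} {P : X -> X -> Type} (h : forall x y, P x y) x y x' y' :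
  x = x' -> y = y' -> JMeq (h x y) (h x' y').
Proof. now intros -> ->. Qed.

Lemma JMeq_app3 {X} {P : X -> X -> X -> Type} (h : forall x y z, P x y z) x y z x' y' z' :
  x = x' -> y = y' -> z = z' -> JMeq (h x y z) (h x' y' z').
Proof. now intros -> -> ->. Qed.

Lemma sinterp_opp C {u v : word (ob C)} (f : smor u v) :
  JMeq (sinterp (opp C) (sinv f)) (sinterp C f).
Proof.
  induction f.
  - exact (JMeq_app (fun a => @idm C a) _ _ (wev_opp C _)).
  - apply (JMeq_comp (C := C)); (apply wev_opp || assumption).
  - apply (JMeq_tens (C := C)); (apply wev_opp || assumption).
  - exact (JMeq_app3 (@alpha C) _ _ _ _ _ _ (wev_opp C _) (wev_opp C _) (wev_opp C _)).
  - exact (JMeq_app3 (@alphainv C) _ _ _ _ _ _ (wev_opp C _) (wev_opp C _) (wev_opp C _)).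
  - exact (JMeq_app (@lambda C) _ _ (wev_opp C _)).
  - exact (JMeq_app (@lambdainv C) _ _ (wev_opp C _)).
  - exact (JMeq_app (@rho C) _ _ (wev_opp C _)).
  - exact (JMeq_app (@rhoinv C) _ _ (wev_opp C _)).
  - exact (JMeq_app2 (@sigma C) _ _ _ _ (wev_opp C _) (wev_opp C _)).
Qed.

Lemma JMeq_ofmap {C D} (F : NormalOplaxSMF C D) a b a' b' (f : hom C a b) (f' : hom C a' b') :
  a = a' -> b = b' -> JMeq f f' -> JMeq (ofmap F f) (ofmap F f').
Proof. intros -> -> E. now rewrite (JMeq_eq E). Qed.

Lemma linterp_opp {C D} (F : NormalOplaxSMF C D) (a b : nob (ob C)) (f : nmor false a b) :
  JMeq (linterp (opp_functor F) (nrev f)) (ointerp F f).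
Proof.
  induction f.
  - exact (JMeq_app (fun a => @idm D a) _ _ (lob_opp F _)).
  - apply (JMeq_comp (C := D)); (apply lob_opp || assumption).
  - apply (JMeq_tens (C := D)); (apply lob_opp || assumption).
  - exact (JMeq_app3 (@alpha D) _ _ _ _ _ _ (lob_opp F _) (lob_opp F _) (lob_opp F _)).
  - exact (JMeq_app3 (@alphainv D) _ _ _ _ _ _ (lob_opp F _) (lob_opp F _) (lob_opp F _)).
  - exact (JMeq_app (@lambda D) _ _ (lob_opp F _)).
  - exact (JMeq_app (@lambdainv D) _ _ (lob_opp F _)).
  - exact (JMeq_app (@rho D) _ _ (lob_opp F _)).
  - exact (JMeq_app (@rhoinv D) _ _ (lob_opp F _)).
  - exact (JMeq_app2 (@sigma D) _ _ _ _ (lob_opp F _) (lob_opp F _)).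
  - apply (JMeq_ofmap F); (exact (wev_opp C _) || exact (sinterp_opp C s)).
  - reflexivity.
  - reflexivity.
  - exact (JMeq_app2 (delta F) _ _ _ _ (wev_opp C _) (wev_opp C _)).
Qed.

Theorem oplax_coherence {C D} (F : NormalOplaxSMF C D) (a b : nob (ob C)) (f g : nmor false a b) :
  (forall p, nmap f p = nmap g p) -> ointerp F f = ointerp F g.
Proof.
  intros H. apply JMeq_eq.
  eapply JMeq_trans; [apply JMeq_sym, linterp_opp|].
  rewrite (lax_coherence (opp_functor F) b a (nrev f) (nrev g) (nmap_nrev f g H)).
  apply linterp_opp.
Qed.

(** * Occurrences as positions in the list of letters *)

Fixpoint index {T} (u : word T) : pos u -> nat :=
  match u with
  | wI => fun p => match p with end
  | wv _ => fun _ => 0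
  | wt u v => fun p => match p with inl p => index u p | inr p => wlen u + index v p end
  end.

Local Arguments wlen : simpl never.

Lemma wlen_wt {T} (u v : word T) : wlen (wt u v) = wlen u + wlen v.
Proof. apply length_app. Qed.

Lemma index_lt {T} (u : word T) p : index u p < wlen u.
Proof.
  induction u; cbn in *; split_pos; cbn; rewrite ?wlen_wt.
  - apply Nat.lt_0_1.
  - specialize (IHu1 p). lia.
  - specialize (IHu2 p). lia.
Qed.

Lemma index_inj {T} (u : word T) p q : index u p = index u q -> p = q.
Proof.
  induction u; cbn in *; intros E.
  - destruct p.
  - now destruct p, q.
  - destruct p as [p|p], q as [q|q]; cbn in E; f_equal.
    + now apply IHu1.
    + pose proof (index_lt u1 p). lia.
    + pose proof (index_lt u1 q). lia.
    + apply IHu2. lia.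
Qed.

Lemma index_nth {T} (u : word T) p : nth_error (wletters u) (index u p) = Some (letter u p).
Proof.
  induction u; cbn in *; split_pos; auto.
  - rewrite nth_error_app1; [apply IHu1|apply index_lt].
  - rewrite nth_error_app2; fold (wlen u1); [|lia].
    now replace (wlen u1 + index u2 p - wlen u1) with (index u2 p) by lia.
Qed.

Lemma tens_index {T} (u v u' v' : word T) (f : pos u -> pos u') (g : pos v -> pos v') F G p :
  (forall p, F (index u p) = index u' (f p)) -> (forall p, G (index v p) = index v' (g p)) ->
  (if index (wt u v) p <? wlen u then F (index (wt u v) p)
   else wlen u' + G (index (wt u v) p - wlen u))
  = index (wt u' v') (match p with inl p => inl (f p) | inr p => inr (g p) end).
Proof.
  intros HF HG. destruct p as [p|p]; cbn [index].
  - now rewrite (proj2 (Nat.ltb_lt _ _) (index_lt u p)).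
  - rewrite (proj2 (Nat.ltb_ge _ _)) by lia.
    now replace (wlen u + index v p - wlen u) with (index v p) by lia; rewrite HG.
Qed.

Lemma sigma_index {T} (u v : word T) (p : pos (wt u v)) :
  (if index (wt u v) p <? wlen u then wlen v + index (wt u v) p else index (wt u v) p - wlen u)
  = index (wt v u) (match p with inl p => inr p | inr p => inl p end).
Proof.
  destruct p as [p|p]; cbn [index].
  - now rewrite (proj2 (Nat.ltb_lt _ _) (index_lt u p)).
  - rewrite (proj2 (Nat.ltb_ge _ _)) by lia. lia.
Qed.

Lemma sperm_index {T} {u v : word T} (f : smor u v) p : sperm f (index u p) = index v (smap f p).
Proof.
  induction f.
  - reflexivity.
  - cbn. now rewrite IHf2, IHf1.
  - now apply tens_index.
  - cbn in *; split_pos; cbn; rewrite ?wlen_wt; lia.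
  - cbn in *; split_pos; cbn; rewrite ?wlen_wt; lia.
  - cbn in *; split_pos; reflexivity.
  - reflexivity.
  - cbn in *; split_pos; reflexivity.
  - reflexivity.
  - apply sigma_index.
Qed.

Lemma wletters_flat {T} (a : nob T) : wletters (flat a) = nletters a.
Proof. induction a; cbn; congruence. Qed.

Lemma nlen_flat {T} (a : nob T) : nlen a = wlen (flat a).
Proof. unfold nlen, wlen. now rewrite wletters_flat. Qed.

Lemma nperm_index {T lax} {a b : nob T} (f : nmor lax a b) (p : npos a) :
  nperm f (index (flat a) p) = index (flat b) (nmap f p).
Proof.
  induction f; unfold npos, nmap in *.
  - reflexivity.
  - exact (eq_trans (f_equal (nperm f1) (IHf2 p)) (IHf1 _)).
  - cbn [nperm]. rewrite !nlen_flat. now apply tens_index.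
  - cbn in *; split_pos; cbn; rewrite ?wlen_wt; lia.
  - cbn in *; split_pos; cbn; rewrite ?wlen_wt; lia.
  - cbn in *; split_pos; reflexivity.
  - reflexivity.
  - cbn in *; split_pos; reflexivity.
  - reflexivity.
  - cbn [nperm]. rewrite !nlen_flat. apply sigma_index.
  - apply sperm_index.
  - reflexivity.
  - reflexivity.
  - now destruct lax.
Qed.

Lemma same_bijection_nmap {T lax} {a b : nob T} (f g : nmor lax a b) :
  same_bijection f g -> forall p, nmap f p = nmap g p.
Proof.
  intros H p. apply index_inj. rewrite <- !nperm_index. apply H.
  rewrite nlen_flat. apply index_lt.
Qed.

(** Formal morphisms preserve letters. Pulling the image of [p] under [g] back along [f] gives an
    occurrence of the same letter as [p], which is [p] itself when letters are distinct. *)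
Lemma NoDup_nmap {T lax} {a b : nob T} (f g : nmor lax a b) :
  NoDup (nletters a) -> forall p, nmap f p = nmap g p.
Proof.
  intros N p. rewrite <- wletters_flat in N.
  set (q := smap (sinv (flatten f)) (nmap g p)).
  assert (E : q = p).
  { apply index_inj, (proj1 (NoDup_nth_error _) N); [apply index_lt|].
    rewrite !index_nth. unfold q, nmap. now rewrite !letter_smap. }
  rewrite <- E at 1. apply smap_sinv.
Qed.

Theorem mainTheorem13 :
  (* normal lax: same occurrence bijection => equal formal morphisms *)
  (forall (C D : SymMonCat) (F : NormalLaxSMF C D) (a b : nob (ob C))
          (f g : nmor true a b),
      same_bijection f g -> linterp F f = linterp F g)
  /\
  (* normal oplax: same statement *)
  (forall (C D : SymMonCat) (F : NormalOplaxSMF C D) (a b : nob (ob C))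
          (f g : nmor false a b),
      same_bijection f g -> ointerp F f = ointerp F g)
  /\
  (* in particular: distinct letters => all formal diagrams commute *)
  (forall (C D : SymMonCat) (F : NormalLaxSMF C D) (a b : nob (ob C))
          (f g : nmor true a b),
      NoDup (nletters a) -> linterp F f = linterp F g)
  /\
  (forall (C D : SymMonCat) (F : NormalOplaxSMF C D) (a b : nob (ob C))
          (f g : nmor false a b),
      NoDup (nletters a) -> ointerp F f = ointerp F g).
Proof.
  split; [|split; [|split]]; intros; [apply lax_coherence|apply oplax_coherence
    |apply lax_coherence|apply oplax_coherence];
    auto using same_bijection_nmap, NoDup_nmap.
Qed.
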